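(* Let $\alpha>0$ and let $\mu$ be a positive Borel measure on $(0,\infty)$ with $\int_0^\infty \frac{d\mu(t)}{t}=1$. The following are equivalent: (i) There exist $0<p<q\le\infty$ such that $\mathcal{H}_\mu:F^{p}_{\alpha}\to F^{q}_{\alpha}$ is bounded. (ii) $\mathcal{H}_\mu:F^{p}_{\alpha}\to F^{p}_{\alpha}$ is bounded for all $0<p\le\infty$.
   Context: For $\alpha>0$, $F^p_\alpha$ is the space of entire functions $f$ with $\|f\|_{p,\alpha}<\infty$, where $\|f\|_{p,\alpha}=\left(\frac{\alpha p}{2\pi}\int_{\mathbb C}|f(z)e^{-\frac{\alpha}{2}|z|^2}|^p\,dA(z)\right)^{1/p}$ for $0<p<\infty$ ($dA$ is area measure) and $\|f\|_{\infty,\alpha}=\sup_{z\in\mathbb C}|f(z)|e^{-\frac{\alpha}{2}|z|^2}$. The Hausdorff operator is $\mathcal{H}_\mu(f)(z)=\int_0^\infty f\left(\frac{z}{t}\right)\frac{d\mu(t)}{t}$ for entire $f$. ''$\mathcal{H}_\mu:X\to Y$ is bounded'' means it is well defined on $X$ with values in $Y$ and there is $C>0$ with $\|\mathcal{H}_\mu f\|_Y\le C\|f\|_X$ for all $f\in X$. *)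

(* Defs.v *)
From HB Require Import structures.
From mathcomp Require Import all_boot all_order all_algebra.
From mathcomp Require Import complex.
From mathcomp Require Import all_classical all_reals all_analysis.

Set Implicit Arguments.
Unset Strict Implicit.
Unset Printing Implicit Defensive.

Import Order.TTheory GRing.Theory Num.Theory.
Import numFieldNormedType.Exports.
Import ComplexField.Normc.

Local Open Scope classical_set_scope.
Local Open Scope complex_scope.
Local Open Scope ring_scope.

(* [R[i]^o] is [R[i]] seen as a normed space over itself, so that derivability
   in direction 1 is complex differentiability. *)
Definition entire (R : realType) (f : R[i] -> R[i]) : Prop :=
  forall z : R[i], derivable (f : R[i]^o -> R[i]^o) z 1.

Definition fock_weighted (R : realType) (alpha : R) (f : R[i] -> R[i])
    (z : R[i]) : R :=
  normc (f z) * expR (- (alpha / 2) * normc z ^+ 2).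

(* Area measure is the product Lebesgue measure on pairs (Re z, Im z).
   The value at [-oo] is junk; only exponents in (0, +oo] are used. *)
Definition fock_norm (R : realType) (alpha : R) (p : \bar R)
    (f : R[i] -> R[i]) : \bar R :=
  match p with
  | r%:E =>
      ((alpha * r / (2 * pi))%:E *
       \int[(@lebesgue_measure R \x @lebesgue_measure R)%E]_w
         ((fock_weighted alpha f (w.1 +i* w.2)) `^ r)%:E) `^ r^-1
  | +oo => ereal_sup [set (fock_weighted alpha f z)%:E | z in [set: R[i]]]
  | -oo => 0
  end%E.

Definition fock_space (R : realType) (alpha : R) (p : \bar R) :
    set (R[i] -> R[i]) :=
  [set f | entire f /\ (fock_norm alpha p f < +oo)%E].

Definition cintegrable (R : realType) (mu : {measure set R -> \bar R})
    (D : set R) (g : R -> R[i]) : Prop :=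
  mu.-integrable D (fun t => (complex.Re (g t))%:E) /\
  mu.-integrable D (fun t => (complex.Im (g t))%:E).

Definition cintegral (R : realType) (mu : {measure set R -> \bar R})
    (D : set R) (g : R -> R[i]) : R[i] :=
  Rintegral mu D (fun t => complex.Re (g t)) +i*
  Rintegral mu D (fun t => complex.Im (g t)).

Definition hausdorff_integrand (R : realType) (f : R[i] -> R[i]) (z : R[i])
    (t : R) : R[i] :=
  f (z / t%:C) / t%:C.

Definition hausdorff (R : realType) (mu : {measure set R -> \bar R})
    (f : R[i] -> R[i]) (z : R[i]) : R[i] :=
  cintegral mu `]0, +oo[ (hausdorff_integrand f z).

Definition hausdorff_bounded (R : realType) (mu : {measure set R -> \bar R})
    (alpha : R) (p q : \bar R) : Prop :=
  (forall f, fock_space alpha p f ->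
     (forall z, cintegrable mu `]0, +oo[ (hausdorff_integrand f z)) /\
     fock_space alpha q (hausdorff mu f)) /\
  (exists C : R, 0 < C /\
     forall f, fock_space alpha p f ->
       (fock_norm alpha q (hausdorff mu f) <= C%:E * fock_norm alpha p f)%E).

(* Main.v *)
(** Testing boundedness on the monomials [z ^ n], which are eigenvectors of the
    Hausdorff operator, at the point where [|z| ^ n e^(- alpha |z|^2 / 2)] is
    maximal shows that the moments [\int t^(-n-1) dmu] grow slower than any
    exponential, so [mu] does not charge (0, 1).  Conversely, if [mu] lives on
    [1, +oo) then [|H f (z)|] is at most twice the supremum of [|f (s z)|] over
    [0 <= s <= 1].  Since [(1 - s)^2 <= 1 - s^2], the Gaussian weight turns the
    sub-mean value property at [s z] into a bound of this radial maximal function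
    (raised to the power [p], for any [p > 0]) by the convolution of
    [(|f| e^(- alpha |.|^2 / 2))^p] with a Gaussian, and Tonelli's theorem
    concludes.  The passage from exponents [p, p] to [p < q] is the embedding of
    [F^p] in [F^oo].

    Entire functions are only assumed to be complex differentiable at each point,
    so Cauchy's formula rests on Goursat's bisection argument. *)
From HB Require Import structures.
Require Import Defs.
From mathcomp Require Import all_boot all_order all_algebra.
From mathcomp Require Import complex.
From mathcomp Require Import all_classical all_reals all_analysis.
From mathcomp Require Import measurable_realfun.
From mathcomp Require Import ring lra.

Set Implicit Arguments.
Unset Strict Implicit.
Unset Printing Implicit Defensive.

Import Order.TTheory GRing.Theory Num.Theory.
Import numFieldNormedType.Exports.
Import ComplexField.Normc.

Local Open Scope classical_set_scope.
Local Open Scope complex_scope.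
Local Open Scope ring_scope.

(** * Complex differentiability *)

Section complex_basics.
Context {R : realType}.
Implicit Types (z w h d : R[i]) (f g : R[i] -> R[i]).
Local Notation Re := (@complex.Re R).
Local Notation Im := (@complex.Im R).

(** Exponents below 1 are included, so Minkowski's inequality cannot move the integral over [t]
    outside the norm. The sufficiency direction therefore works pointwise in [z], with a kernel that
    does not depend on [s]. Moving the weight from [z] to [s z] leaves a spare factor
    [exp (- alpha (1 - s^2) |z|^2 / 2)], and this factor pays for centring the Gaussian at [z]
    instead of [s z]. One convolution then dominates all dilations at once, and only its mass enters
    the final constant.

    In the necessity direction, comparing [||z^n||_p] with the maximum of the weighted monomial
    would exactly be a Gamma function estimate. A cruder bound is enough: for any [kappa < 1] the
    ratio is [O (kappa^-n)]. This loss is affordable because [mu (0, a]] enters with the factor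
    [a^-n], and [kappa] can be chosen between [a] and 1.

    Contours are rectangles and discs are replaced by squares throughout, so that every line
    integral is a Lebesgue integral over a real segment and the value [2 pi i] comes from the
    arctangent. *)

Lemma normc_normr (z : R[i]) : `|z| = (normc z)%:C.
Proof. by case: z. Qed.

Lemma normc_ge0 z : 0 <= normc z.
Proof. by case: z => a b; exact: sqrtr_ge0. Qed.

Lemma ler_normcD z w : normc (z + w) <= normc z + normc w.
Proof. by rewrite -lecR rmorphD/=; exact: (@ler_normD _ R[i]). Qed.

Lemma normcN z : normc (- z) = normc z.
Proof. by case: z => a b /=; rewrite !sqrrN. Qed.

Lemma sqr_normc z : normc z ^+ 2 = Re z ^+ 2 + Im z ^+ 2.
Proof. by case: z => a b /=; rewrite sqr_sqrtr// addr_ge0// sqr_ge0. Qed.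

Lemma Re_le_normc z : `|Re z| <= normc z.
Proof.
rewrite -(@ler_pXn2r _ 2)// ?nnegrE ?normc_ge0// sqr_normc real_normK ?num_real//.
by rewrite lerDl sqr_ge0.
Qed.

Lemma Im_le_normc z : `|Im z| <= normc z.
Proof.
rewrite -(@ler_pXn2r _ 2)// ?nnegrE ?normc_ge0// sqr_normc real_normK ?num_real//.
by rewrite lerDr sqr_ge0.
Qed.

Lemma normc_le_ReIm z : normc z <= `|Re z| + `|Im z|.
Proof.
rewrite -(@ler_pXn2r _ 2)// ?nnegrE ?normc_ge0 ?addr_ge0// sqr_normc sqrrD.
rewrite !real_normK ?num_real// -addrA [X in _ <= _ + X]addrC addrA lerDl.
by rewrite mulrn_wge0// mulr_ge0.
Qed.

Lemma normcR (x : R) : normc x%:C = `|x|.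
Proof. by rewrite /normc /= expr0n/= addr0 sqrtr_sqr. Qed.

Lemma normcB z w : normc (z - w) = normc (w - z).
Proof. by rewrite -opprB normcN. Qed.

Lemma normc_eq0 z : (normc z == 0) = (z == 0).
Proof. by apply/eqP/eqP => [/eq0_normc//|->]; rewrite normc0. Qed.

Lemma normc_gt0 z : (0 < normc z) = (z != 0).
Proof. by rewrite lt_def normc_ge0 andbT normc_eq0. Qed.

(** A quotient-free first-order expansion with radii and errors in [R]: the increment 0 needs no
    special treatment, and remainders can be integrated directly. *)
Definition cderiv f z d := forall e : R, 0 < e -> exists2 r : R, 0 < r &
  forall h, normc h < r -> normc (f (z + h) - f z - d * h) <= e * normc h.

Definition ccont f z := forall e : R, 0 < e -> exists2 r : R, 0 < r &
  forall h, normc h < r -> normc (f (z + h) - f z) <= e.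

Lemma cderiv_ccont f z d : cderiv f z d -> ccont f z.
Proof.
move=> fd e e0; have [r r0 H] := fd 1 ltr01.
have K0 : 0 < 1 + normc d by rewrite ltr_pwDl// normc_ge0.
exists (Num.min r (e / (1 + normc d))) => [|h].
  by rewrite lt_min r0 divr_gt0.
rewrite lt_min => /andP[hr]; rewrite ltr_pdivlMr// => he.
rewrite -[X in normc X](subrK (d * h)) (le_trans (ler_normcD _ _))//.
by rewrite normcM (le_trans _ (ltW he))// mulrDr mulr1 [normc d * _]mulrC lerD2r
  (le_trans (H _ hr))// mul1r.
Qed.

(** Balls of [R[i]^o] have radii in [R[i]]; a positive element there is real, which brings the
    radius back to [R]. *)
Lemma nbhs_normc z (P : set R[i]) :
  nbhs (z : R[i]^o) P <-> exists2 r : R, 0 < r & forall h, normc h < r -> P (z + h).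
Proof.
split.
  move=> /nbhs_ballP[e /= e0 H].
  have eE : e = (complex.Re e)%:C by rewrite RRe_real// gtr0_real.
  exists (complex.Re e); first by rewrite -ltcR -eE.
  move=> h hr; apply: H; rewrite -ball_normE /= opprD addNKr normrN normc_normr eE ltcR.
  by [].
move=> [r r0 H]; apply/nbhs_ballP; exists r%:C => /=; first by rewrite ltcR.
move=> y; rewrite -ball_normE /= distrC normc_normr ltcR => /H.
by rewrite addrC subrK.
Qed.

Lemma derivableP_cderiv f z : derivable (f : R[i]^o -> R[i]^o) z 1 <-> exists d, cderiv f z d.
Proof.
split.
  move=> /cvg_ex[/= d fd]; exists d => e e0.
  have := fd (ball d e%:C) (nbhsx_ballx (d : R[i]^o) e%:C _).
  rewrite ltcR => /(_ e0).
  rewrite /nbhs/=/dnbhs/within/= => /nbhs_normc[r r0 H].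
  exists r => // h hr.
  have [->|h0] := eqVneq h 0; first by rewrite addr0 subrr mulr0 subrr normc0 mulr0.
  have := H h hr; rewrite add0r => /(_ h0).
  rewrite -ball_normE/= normc_normr ltcR => {}H.
  rewrite -(@ler_pM2r _ (normc h)^-1) ?invr_gt0 ?normc_gt0//.
  rewrite -mulrA divff ?normc_eq0// mulr1 -normcV -normcM.
  apply/ltW; move: H; rewrite normcB; congr (normc _ < e).
  rewrite [h *: _]mulr1 /= [h + z]addrC mulrBl mulfK//; congr (_ - _).
  by rewrite [_ *: _]/(_ * _) mulrC.
move=> [d fd]; apply/cvg_ex; exists d => /= A /nbhs_normc[e e0 eA].
have [r r0 H] := fd (e / 2) (divr_gt0 e0 (ltr0n _ 2)).
rewrite /nbhs/=/dnbhs/within/=; apply/nbhs_normc; exists r => // h hr; rewrite add0r => h0.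
set q := _ *: _; rewrite -[q](subrK d) addrC; apply: eA.
have {}H := H h hr.
have h0' : 0 < normc h by rewrite normc_gt0.
apply: (@le_lt_trans _ _ (e / 2)); last by rewrite ltr_pdivrMr// ltr_pMr// ltr1n.
rewrite -(ler_pM2r h0') -normcM; apply: le_trans H.
rewrite le_eqVlt; apply/orP; left; apply/eqP; congr normc.
rewrite /q mulrBl; congr (_ - _).
rewrite [_ *: _]/(_ * _) mulrAC mulVf// mul1r; congr (f _ - _); by rewrite [h *: _]mulr1 addrC.
Qed.

End complex_basics.

(** * Integration of complex-valued functions *)

(* [cintegral] of Defs is the instance [T = R] with its default display; line
   integrals against [lebesgue_measure] live on [measurableTypeR R]. *)
Section cxintegral_def.
Context {d : measure_display} {T : measurableType d} {R : realType}.
Variable mu : {measure set T -> \bar R}.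

Definition cxintegrable (D : set T) (g : T -> R[i]) : Prop :=
  mu.-integrable D (fun t => (complex.Re (g t))%:E) /\
  mu.-integrable D (fun t => (complex.Im (g t))%:E).

Definition cxintegral (D : set T) (g : T -> R[i]) : R[i] :=
  (\int[mu]_(t in D) complex.Re (g t)) +i* (\int[mu]_(t in D) complex.Im (g t)).

End cxintegral_def.

Section cxintegral_theory.
Context {d : measure_display} {T : measurableType d} {R : realType}.
Variable mu : {measure set T -> \bar R}.
Variables (D : set T) (mD : measurable D).
Implicit Types (g : T -> R[i]) (k : R[i]).
Local Notation Re := (@complex.Re R).
Local Notation Im := (@complex.Im R).

Lemma Re_addc (z w : R[i]) : Re (z + w) = Re z + Re w.
Proof. by case: z; case: w. Qed.

Lemma Im_addc (z w : R[i]) : Im (z + w) = Im z + Im w.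
Proof. by case: z; case: w. Qed.

Lemma Re_mulc (z w : R[i]) : Re (z * w) = Re z * Re w - Im z * Im w.
Proof. by case: z; case: w. Qed.

Lemma Im_mulc (z w : R[i]) : Im (z * w) = Re z * Im w + Im z * Re w.
Proof. by case: z; case: w. Qed.


Lemma integrable_scale (k : R) (u : T -> R) : mu.-integrable D (EFin \o u) ->
  mu.-integrable D (EFin \o (fun t => k * u t)).
Proof. by move=> iu; apply: eq_integrable (integrableZl mD k iu). Qed.

Lemma cxintegrableD g1 g2 : cxintegrable mu D g1 -> cxintegrable mu D g2 ->
  cxintegrable mu D (fun t => g1 t + g2 t).
Proof.
move=> [r1 i1] [r2 i2]; split.
  by apply: eq_integrable (integrableD mD r1 r2) => // t _; rewrite Re_addc.
by apply: eq_integrable (integrableD mD i1 i2) => // t _; rewrite Im_addc.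
Qed.

Lemma cxintegrableZ k g : cxintegrable mu D g -> cxintegrable mu D (fun t => k * g t).
Proof.
move=> [r i]; split.
  apply: eq_integrable (integrableB mD (integrableZl mD (Re k) r) (integrableZl mD (Im k) i))
    => // t _.
  by rewrite Re_mulc /= -EFinM -EFinB.
apply: eq_integrable (integrableD mD (integrableZl mD (Re k) i) (integrableZl mD (Im k) r))
  => // t _.
by rewrite Im_mulc /= -!EFinM -EFinD.
Qed.

Lemma cxintegrableN g : cxintegrable mu D g -> cxintegrable mu D (fun t => - g t).
Proof.
move=> /(cxintegrableZ (-1)) H; apply: eq_ind H _ _.
by apply/funext => t; rewrite mulN1r.
Qed.

Lemma cxintegrableB g1 g2 : cxintegrable mu D g1 -> cxintegrable mu D g2 ->
  cxintegrable mu D (fun t => g1 t - g2 t).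
Proof. by move=> h1 /cxintegrableN; exact: cxintegrableD. Qed.

Lemma cxintegralD g1 g2 : cxintegrable mu D g1 -> cxintegrable mu D g2 ->
  cxintegral mu D (fun t => g1 t + g2 t) = cxintegral mu D g1 + cxintegral mu D g2.
Proof.
move=> [r1 i1] [r2 i2]; rewrite /cxintegral /=; congr Complex.
  by rewrite -RintegralD//; apply: eq_Rintegral => t _; rewrite Re_addc.
by rewrite -RintegralD//; apply: eq_Rintegral => t _; rewrite Im_addc.
Qed.

Lemma cxintegralZ k g : cxintegrable mu D g ->
  cxintegral mu D (fun t => k * g t) = k * cxintegral mu D g.
Proof.
move=> [r i]; rewrite /cxintegral; case: k => a b /=; congr Complex.
  rewrite -!RintegralZl// -RintegralB//; [|exact: integrable_scale..].
  by apply: eq_Rintegral => t _; rewrite Re_mulc.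
rewrite -!RintegralZl// -RintegralD//; [|exact: integrable_scale..].
by apply: eq_Rintegral => t _; rewrite Im_mulc.
Qed.

Lemma cxintegralB g1 g2 : cxintegrable mu D g1 -> cxintegrable mu D g2 ->
  cxintegral mu D (fun t => g1 t - g2 t) = cxintegral mu D g1 - cxintegral mu D g2.
Proof.
move=> h1 h2; rewrite -[RHS]/(_ + - _) -mulN1r -cxintegralZ// -cxintegralD//.
  by congr cxintegral; apply/funext => t; rewrite mulN1r.
exact: cxintegrableZ.
Qed.

(** The factor 2 comes from bounding the real and imaginary parts separately, each by the integral
    of [phi]. *)
Lemma normc_cxintegral_le g (phi : T -> R) : cxintegrable mu D g ->
  mu.-integrable D (EFin \o phi) -> (forall t, D t -> normc (g t) <= phi t) ->
  normc (cxintegral mu D g) <= 2 * \int[mu]_(t in D) phi t.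
Proof.
move=> [r i] iphi H; rewrite (le_trans (normc_le_ReIm _))//= mulr2n mulrDl mul1r.
have aux (u : T -> R) : mu.-integrable D (EFin \o u) -> (forall t, D t -> `|u t| <= phi t) ->
    `|\int[mu]_(t in D) u t| <= \int[mu]_(t in D) phi t.
  move=> iu uphi; rewrite (le_trans (le_normr_Rintegral mD iu))// le_Rintegral//.
  by apply: eq_integrable (integrable_abse iu).
apply: lerD; apply: aux => // t Dt; apply: le_trans (H _ Dt).
  exact: Re_le_normc.
exact: Im_le_normc.
Qed.

End cxintegral_theory.

Section segment_integral.
Context {R : realType}.
Implicit Types (g : R -> R[i]) (a b c : R).
Local Notation leb := (@lebesgue_measure R).

Definition cint a b g : R[i] := cxintegral leb `[a, b] g.

Definition ccontR g (t : R) := forall e : R, 0 < e -> exists2 r : R, 0 < r &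
  forall h : R, `|h| < r -> normc (g (t + h) - g t) <= e.

Lemma ccontR_continuous g a b : (forall t, a <= t <= b -> ccontR g t) ->
  {within `[a, b], continuous (fun t => complex.Re (g t))} /\
  {within `[a, b], continuous (fun t => complex.Im (g t))}.
Proof.
move=> H; split; apply: continuous_in_subspaceT => t;
  rewrite inE/= in_itv/= => /H gt; apply/cvgrPdist_le => /= e e0;
  have [r r0 {}gt] := gt e e0; apply/nbhs_ballP; exists r => //= s;
  rewrite /ball/= distrC => sr; rewrite distrC -[s](subrK t) [_ + t]addrC;
  apply: le_trans (gt _ sr).
  by apply: le_trans (Re_le_normc _); rewrite raddfB.
by apply: le_trans (Im_le_normc _); rewrite raddfB.
Qed.

Lemma cont_cxintegrable g a b : (forall t, a <= t <= b -> ccontR g t) ->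
  cxintegrable leb `[a, b] g.
Proof.
by move=> /ccontR_continuous[gr gi]; split; apply: continuous_compact_integrable => //;
  exact: segment_compact.
Qed.

Lemma cint_split g a c b : a <= c -> c <= b -> cxintegrable leb `[a, b] g ->
  cint a b g = cint a c g + cint c b g.
Proof.
move=> ac cb [r i].
have aux (u : R -> R) : leb.-integrable `[a, b] (EFin \o u) ->
    \int[leb]_(t in `[a, b]) u t = \int[leb]_(t in `[a, c]) u t + \int[leb]_(t in `[c, b]) u t.
  move=> iu; have := Rintegral_itvB (x := c) iu; rewrite bnd_simp => /(_ ac cb).
  rewrite Rintegral_itv_obnd_cbnd => [/eqP|]; first by rewrite subr_eq addrC => /eqP.
  apply: integrableS iu => //; apply: subset_itv; rewrite bnd_simp//.
by rewrite /cint /cxintegral (aux _ r) (aux _ i).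
Qed.

Lemma integrable_cst_itv (k a b : R) : leb.-integrable `[a, b] (EFin \o cst k).
Proof.
apply: continuous_compact_integrable; first exact: segment_compact.
by apply: continuous_subspaceT => x; exact: cvg_cst.
Qed.

Lemma Rintegral_cst_itv (k a b : R) : a <= b -> \int[leb]_(t in `[a, b]) k = k * (b - a).
Proof.
move=> ab; rewrite Rintegral_cst//= lebesgue_measure_itv/= lte_fin.
move: ab; rewrite le_eqVlt => /predU1P[->|ab]; first by rewrite ltxx subrr mulr0.
by rewrite ab -EFinB.
Qed.

Lemma cint_cst k a b : a <= b -> cint a b (fun=> k) = k * (b - a)%:C.
Proof.
move=> ab; rewrite /cint /cxintegral !Rintegral_cst_itv//.
by case: k => x y /=; simpc.
Qed.

Lemma normc_cint_le g a b (M : R) : a <= b -> cxintegrable leb `[a, b] g ->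
  (forall t, a <= t <= b -> normc (g t) <= M) -> normc (cint a b g) <= 2 * M * (b - a).
Proof.
move=> ab ig H; rewrite -mulrA -Rintegral_cst_itv//.
apply: normc_cxintegral_le => //; exact: integrable_cst_itv.
Qed.

Lemma cintD a b g1 g2 : cxintegrable leb `[a, b] g1 -> cxintegrable leb `[a, b] g2 ->
  cint a b (fun t => g1 t + g2 t) = cint a b g1 + cint a b g2.
Proof. exact: cxintegralD. Qed.

Lemma cintB a b g1 g2 : cxintegrable leb `[a, b] g1 -> cxintegrable leb `[a, b] g2 ->
  cint a b (fun t => g1 t - g2 t) = cint a b g1 - cint a b g2.
Proof. exact: cxintegralB. Qed.

Lemma cintZ a b k g : cxintegrable leb `[a, b] g ->
  cint a b (fun t => k * g t) = k * cint a b g.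
Proof. exact: cxintegralZ. Qed.

End segment_integral.

(** * Goursat's theorem *)

Section bisection.
Context {R : realType}.

Lemma nested_intervals (a b : nat -> R) : (forall n, a n <= a n.+1) ->
  (forall n, b n.+1 <= b n) -> (forall n, a n <= b n) ->
  exists x, forall n, a n <= x <= b n.
Proof.
move=> ha hb hab.
have ma m n : (m <= n)%N -> a m <= a n.
  by move=> /subnKC <-; elim: (n - m)%N => [|k IH]; rewrite ?addn0// addnS (le_trans IH).
have mb m n : (m <= n)%N -> b n <= b m.
  by move=> /subnKC <-; elim: (n - m)%N => [|k IH]; rewrite ?addn0// addnS (le_trans _ IH).
have ub n : ubound (range a) (b n).
  move=> _ [m _ <-]; rewrite (le_trans (ma _ _ (leq_maxl m n)))//.
  by rewrite (le_trans (hab _))// mb// leq_maxr.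
exists (sup (range a)) => n; apply/andP; split.
  by apply: ub_le_sup; [exists (b 0%N); exact: ub|exists n].
by apply: ge_sup; [exists (a 0%N), 0%N|exact: ub].
Qed.

Lemma exists_half_pow_lt (K r : R) : 0 < r -> exists n, K / 2 ^+ n < r.
Proof.
move=> r0; exists (Num.bound `|K / r|); rewrite ltr_pdivrMr ?exprn_gt0//.
rewrite mulrC -ltr_pdivrMr// (le_lt_trans (ler_norm _))//.
apply: (lt_le_trans (archi_boundP (normr_ge0 _))).
by rewrite -natrX ler_nat ltnW// ltn_expl.
Qed.

(** An induction principle in the style of Cousin's lemma: if [P] failed, it would fail on one
    quarter, then on a quarter of that, and so on; the nested rectangles shrink to a point around
    which [P] holds for all small rectangles. *)
Lemma rect_bisection (P : R -> R -> R -> R -> Prop) a0 b0 c0 d0 :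
  (forall a b c d, a <= b -> c <= d ->
    P a ((a + b) / 2) c ((c + d) / 2) -> P a ((a + b) / 2) ((c + d) / 2) d ->
    P ((a + b) / 2) b c ((c + d) / 2) -> P ((a + b) / 2) b ((c + d) / 2) d ->
    P a b c d) ->
  a0 <= b0 -> c0 <= d0 ->
  (forall x y, a0 <= x <= b0 -> c0 <= y <= d0 -> exists2 r, 0 < r &
    forall a b c d, a <= x <= b -> c <= y <= d -> b - a < r -> d - c < r ->
    P a b c d) ->
  P a0 b0 c0 d0.
Proof.
move=> herit ab0 cd0 loc; apply: contrapT => nP.
pose bad (q : R * R * R * R) :=
  let: (a, b, c, d) := q in [/\ a <= b, c <= d & ~ P a b c d].
pose sub (q q' : R * R * R * R) :=
  let: (a, b, c, d) := q in let: (a', b', c', d') := q' in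
  [/\ a <= a', b' <= b, c <= c', d' <= d & b' - a' = (b - a) / 2 /\ d' - c' = (d - c) / 2].
(* The existential stands outside the implication, so that [choice] yields a step function defined
   on all quadruples, which can be iterated. *)
have stepP q : exists q', bad q -> bad q' /\ sub q q'.
  have [bq|nb] := pselect (bad q); last by exists q.
  case: q bq => [[[a b] c] d] [ab cd nPq].
  have [P1|N1] := pselect (P a ((a + b) / 2) c ((c + d) / 2)); last first.
    by exists (a, (a + b) / 2, c, (c + d) / 2) => _; split; split=> //; try lra; split; lra.
  have [P2|N2] := pselect (P a ((a + b) / 2) ((c + d) / 2) d); last first.
    by exists (a, (a + b) / 2, (c + d) / 2, d) => _; split; split=> //; try lra; split; lra.
  have [P3|N3] := pselect (P ((a + b) / 2) b c ((c + d) / 2)); last first.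
    by exists ((a + b) / 2, b, c, (c + d) / 2) => _; split; split=> //; try lra; split; lra.
  have [P4|N4] := pselect (P ((a + b) / 2) b ((c + d) / 2) d); last first.
    by exists ((a + b) / 2, b, (c + d) / 2, d) => _; split; split=> //; try lra; split; lra.
  by exfalso; apply/nPq/herit.
have [step stepE] := choice stepP.
pose q n := iter n step (a0, b0, c0, d0).
have bq n : bad (q n) by elim: n => [//|n /stepE[]].
have sq n : sub (q n) (q n.+1) by have [] := stepE _ (bq n).
pose a n := (q n).1.1.1; pose b n := (q n).1.1.2; pose c n := (q n).1.2; pose d n := (q n).2.
have qE n : q n = (a n, b n, c n, d n) by rewrite /a/b/c/d; case: (q n) => [[[]]].
have {}bq n : [/\ a n <= b n, c n <= d n & ~ P (a n) (b n) (c n) (d n)].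
  by have := bq n; rewrite qE.
have {}sq n : [/\ a n <= a n.+1, b n.+1 <= b n, c n <= c n.+1, d n.+1 <= d n &
    b n.+1 - a n.+1 = (b n - a n) / 2 /\ d n.+1 - c n.+1 = (d n - c n) / 2].
  by have := sq n; rewrite !qE.
have [||| x hx] := @nested_intervals a b; try by move=> n; have [] := sq n; have [] := bq n.
have [||| y hy] := @nested_intervals c d; try by move=> n; have [] := sq n; have [] := bq n.
have [r r0 Hr] := loc x y (hx 0%N) (hy 0%N).
have wab n : b n - a n = (b0 - a0) / 2 ^+ n.
  elim: n => [|n IH]; first by rewrite expr0 divr1.
  by have [_ _ _ _ [-> _]] := sq n; rewrite IH exprSr invfM mulrA.
have wcd n : d n - c n = (d0 - c0) / 2 ^+ n.
  elim: n => [|n IH]; first by rewrite expr0 divr1.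
  by have [_ _ _ _ [_ ->]] := sq n; rewrite IH exprSr invfM mulrA.
have [n hn] := exists_half_pow_lt (b0 - a0 + (d0 - c0)) r0.
have [_ _ nPn] := bq n; apply/nPn/Hr => //.
  rewrite wab (le_lt_trans _ hn)// ler_pM2r ?invr_gt0 ?exprn_gt0//; lra.
rewrite wcd (le_lt_trans _ hn)// ler_pM2r ?invr_gt0 ?exprn_gt0//; lra.
Qed.

End bisection.

(** * Integrals along the boundary of a rectangle *)

Section rectangle_integral.
Context {R : realType}.
Implicit Types (f g : R[i] -> R[i]) (a b c d x y m : R) (z w : R[i]).
Local Notation Re := (@complex.Re R).
Local Notation Im := (@complex.Im R).
Local Notation leb := (@lebesgue_measure R).

(* Integral along the positively oriented boundary of [[a, b] x [c, d]]; opposite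
   edges are subtracted before integrating, so that additivity in the rectangle
   and the vanishing on affine functions are immediate. *)
Definition rint f a b c d : R[i] :=
  cint a b (fun x => f (x +i* c) - f (x +i* d)) +
  'i * cint c d (fun y => f (b +i* y) - f (a +i* y)).

Definition in_rect a b c d (z : R[i]) := a <= Re z <= b /\ c <= Im z <= d.

Lemma in_rect_sub a b c d a' b' c' d' z : a <= a' -> b' <= b -> c <= c' -> d' <= d ->
  in_rect a' b' c' d' z -> in_rect a b c d z.
Proof.
move=> aa bb cc dd [/andP[h1 h2] /andP[h3 h4]].
split; apply/andP; split; [exact: le_trans h1|exact: le_trans bb|exact: le_trans h3|exact:
  le_trans dd].
Qed.

Lemma normc_in_rect a b c d z w : in_rect a b c d z -> in_rect a b c d w ->
  normc (z - w) <= b - a + (d - c).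
Proof.
move=> [/andP[z1 z2] /andP[z3 z4]] [/andP[w1 w2] /andP[w3 w4]].
rewrite (le_trans (normc_le_ReIm _))// !raddfB /=.
by apply: lerD; rewrite ler_distl; apply/andP; split; lra.
Qed.

Definition on_bd a b c d (z : R[i]) := in_rect a b c d z /\
  [\/ Re z = a, Re z = b, Im z = c | Im z = d].

(** Continuity is asked on the boundary only, so that the calculus of [rint] applies to Cauchy
    kernels with a pole inside the rectangle. *)
Definition bd_cont f a b c d := forall z, on_bd a b c d z -> ccont f z.

Lemma complexD (x y u v : R) : (x +i* y) + (u +i* v) = (x + u) +i* (y + v).
Proof. by []. Qed.

Lemma complexB (x y u v : R) : (x +i* y) - (u +i* v) = (x - u) +i* (y - v).
Proof. by []. Qed.

Lemma ccont_hor f x y : ccont f (x +i* y) -> ccontR (fun t => f (t +i* y)) x.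
Proof.
move=> fc e /fc[r r0 H]; exists r => // h hr.
have := H h%:C; rewrite normcR => /(_ hr).
by rewrite complexD addr0.
Qed.

Lemma ccont_ver f x y : ccont f (x +i* y) -> ccontR (fun t => f (x +i* t)) y.
Proof.
move=> fc e /fc[r r0 H]; exists r => // h hr.
have := H (0 +i* h); rewrite /= expr0n/= add0r sqrtr_sqr => /(_ hr).
by rewrite complexD addr0.
Qed.

Section cint_edges.
Variables (f : R[i] -> R[i]) (a b c d : R).
Hypotheses (ab : a <= b) (cd : c <= d) (fc : bd_cont f a b c d).

Lemma integrable_bot : cxintegrable leb `[a, b] (fun x => f (x +i* c)).
Proof.
apply: cont_cxintegrable => x xab; apply: ccont_hor; apply: fc.
by split=> /=; [split=> //=; rewrite lexx|constructor 3].
Qed.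

Lemma integrable_top : cxintegrable leb `[a, b] (fun x => f (x +i* d)).
Proof.
apply: cont_cxintegrable => x xab; apply: ccont_hor; apply: fc.
by split=> /=; [split=> //=; rewrite lexx andbT|constructor 4].
Qed.

Lemma integrable_left : cxintegrable leb `[c, d] (fun y => f (a +i* y)).
Proof.
apply: cont_cxintegrable => x xab; apply: ccont_ver; apply: fc.
by split=> /=; [split=> //=; rewrite lexx|constructor 1].
Qed.

Lemma integrable_right : cxintegrable leb `[c, d] (fun y => f (b +i* y)).
Proof.
apply: cont_cxintegrable => x xab; apply: ccont_ver; apply: fc.
by split=> /=; [split=> //=; rewrite lexx andbT|constructor 2].
Qed.

Lemma integrable_hor :
  cxintegrable leb `[a, b] (fun x => f (x +i* c) - f (x +i* d)).
Proof. by apply: cxintegrableB => //; [exact: integrable_bot|exact: integrable_top]. Qed.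

Lemma integrable_ver :
  cxintegrable leb `[c, d] (fun y => f (b +i* y) - f (a +i* y)).
Proof. by apply: cxintegrableB => //; [exact: integrable_right|exact: integrable_left]. Qed.

(** In the constant 4, one factor 2 is that of [normc_cint_le] and the other comes from subtracting
    opposite edges under a single integral. *)
Lemma normc_rint_le (M : R) : (forall z, on_bd a b c d z -> normc (f z) <= M) ->
  normc (rint f a b c d) <= 4 * M * (b - a + (d - c)).
Proof.
move=> H; rewrite (le_trans (ler_normcD _ _))// normcM.
have -> : normc ('i : R[i]) = 1 by rewrite /= expr0n/= add0r expr1n sqrtr1.
rewrite mul1r mulrDr; apply: lerD.
  apply: (le_trans (normc_cint_le (M := 2 * M) ab integrable_hor _)); last by lra.
  move=> x xab; rewrite (le_trans (ler_normcD _ _))// normcN mulr2n mulrDl mul1r.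
  apply: lerD; apply: H; (split; first by split => //=; rewrite lexx ?andbT).
    by constructor 3.
  by constructor 4.
apply: (le_trans (normc_cint_le (M := 2 * M) cd integrable_ver _)); last by lra.
move=> x xab; rewrite (le_trans (ler_normcD _ _))// normcN mulr2n mulrDl mul1r.
apply: lerD; apply: H; (split; first by split => //=; rewrite lexx ?andbT).
  by constructor 2.
by constructor 1.
Qed.

Lemma rintZ k : rint (fun z => k * f z) a b c d = k * rint f a b c d.
Proof.
rewrite /rint mulrDr [k * ('i * _)]mulrCA.
rewrite -(cintZ k integrable_hor) -(cintZ k integrable_ver).
by congr (cint _ _ _ + _ * cint _ _ _); apply/funext => t; rewrite mulrBr.
Qed.

End cint_edges.

Lemma rintD f g a b c d : a <= b -> c <= d -> bd_cont f a b c d -> bd_cont g a b c d ->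
  rint (fun z => f z + g z) a b c d = rint f a b c d + rint g a b c d.
Proof.
move=> ab cd fc gc; rewrite /rint addrACA -mulrDr.
rewrite -(cintD (integrable_hor cd fc) (integrable_hor cd gc)).
rewrite -(cintD (integrable_ver ab fc) (integrable_ver ab gc)).
by congr (cint _ _ _ + _ * cint _ _ _); apply/funext => t; rewrite opprD addrACA.
Qed.

Lemma rint_cst k a b c d : a <= b -> c <= d -> rint (fun=> k) a b c d = 0.
Proof.
move=> ab cd; rewrite /rint.
under [X in cint a b X]eq_fun do rewrite subrr.
under [X in cint c d X]eq_fun do rewrite subrr.
by rewrite !cint_cst// !mul0r mulr0 addr0.
Qed.

Lemma rint_id a b c d : a <= b -> c <= d -> rint id a b c d = 0.
Proof.
move=> ab cd; rewrite /rint.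
have -> : (fun x => (x +i* c : R[i]) - (x +i* d)) = (fun=> 0 +i* (c - d)).
  by apply/funext => x; rewrite complexB subrr.
have -> : (fun x => (b +i* x : R[i]) - (a +i* x)) = (fun=> (b - a) +i* 0).
  by apply/funext => x; rewrite complexB subrr.
rewrite !cint_cst//; apply/eqP; rewrite eq_complex /=; apply/andP; split; apply/eqP; ring.
Qed.

Lemma rint_splitx f a m b c d : a <= m -> m <= b -> c <= d ->
  bd_cont f a b c d -> bd_cont f a m c d ->
  rint f a b c d = rint f a m c d + rint f m b c d.
Proof.
move=> am mb cd f1 f2; have ab := le_trans am mb; rewrite /rint (cint_split am mb); last
  exact: integrable_hor.
rewrite addrACA; congr (_ + _); rewrite -mulrDr; congr (_ * _).
have il := integrable_left ab f1; have im := integrable_right am f2; have ir :=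
  integrable_right ab f1.
rewrite (cintB ir il) (cintB im il) cintB//.
by rewrite [RHS]addrC subrKA.
Qed.

Lemma rint_splity f a b c m d : a <= b -> c <= m -> m <= d ->
  bd_cont f a b c d -> bd_cont f a b c m ->
  rint f a b c d = rint f a b c m + rint f a b m d.
Proof.
move=> ab cm md f1 f2; have cd := le_trans cm md; rewrite /rint (cint_split cm md); last
  exact: integrable_ver.
rewrite mulrDr addrACA; congr (_ + _).
have il := integrable_bot cd f1; have im := integrable_top cm f2; have ir := integrable_top
  cd f1.
rewrite (cintB il ir) (cintB il im) cintB//.
by rewrite subrKA.
Qed.

End rectangle_integral.

Section cauchy.
Context {R : realType}.
Implicit Types (f g : R[i] -> R[i]) (a b c d x y m : R) (z w k : R[i]).
Local Notation Re := (@complex.Re R).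
Local Notation Im := (@complex.Im R).

Definition cdiff f z := derivable (f : R[i]^o -> R[i]^o) z 1.

Lemma cdiff_ccont f z : cdiff f z -> ccont f z.
Proof. by move=> /derivableP_cderiv[d /cderiv_ccont]. Qed.

Lemma cdiff_cst k z : cdiff (fun=> k) z.
Proof. exact: derivable_cst. Qed.

Lemma cdiff_id z : cdiff id z.
Proof. exact: derivable_id. Qed.

Lemma cdiffD f g z : cdiff f z -> cdiff g z -> cdiff (fun z => f z + g z) z.
Proof. exact: derivableD. Qed.

Lemma cdiffB f g z : cdiff f z -> cdiff g z -> cdiff (fun z => f z - g z) z.
Proof. exact: derivableB. Qed.

Lemma cdiffM f g z : cdiff f z -> cdiff g z -> cdiff (fun z => f z * g z) z.
Proof. exact: derivableM. Qed.

Lemma cdiffV f z : f z != 0 -> cdiff f z -> cdiff (fun z => (f z)^-1) z.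
Proof. exact: derivableV. Qed.

(* Near any of its points [f] is affine up to [o(side)] and affine functions have
   zero boundary integral, so the integral over a small rectangle is [o(area)]. *)
Lemma goursat f a b c d : a <= b -> c <= d ->
  (forall z, in_rect a b c d z -> cdiff f z) -> rint f a b c d = 0.
Proof.
move=> ab cd df; apply: eq0_normc; apply/eqP; rewrite eq_le normc_ge0 andbT.
pose S := (b - a) + (d - c).
suff H eta : 0 < eta -> normc (rint f a b c d) <= eta * S ^+ 2.
  apply/ler_addgt0Pl => e e0; rewrite addr0.
  have S0 : 0 < S ^+ 2 + 1 by rewrite ltr_wpDl// sqr_ge0.
  apply: (le_trans (H (e / (S ^+ 2 + 1)) (divr_gt0 e0 S0))).
  by rewrite mulrAC ler_pdivrMr// ler_pM2l// lerDl.
move=> eta0; rewrite /S.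
(* Inclusion in the original rectangle is made part of [P], since [f] is differentiable only there.
   The bound is quadratic in the half-perimeter, so the bounds on the four quarters add up exactly
   to the bound on the whole. *)
pose P a' b' c' d' := a <= a' -> b' <= b -> c <= c' -> d' <= d -> a' <= b' -> c' <= d' ->
  normc (rint f a' b' c' d') <= eta * ((b' - a') + (d' - c')) ^+ 2.
have dfs a' b' c' d' : a <= a' -> b' <= b -> c <= c' -> d' <= d -> bd_cont f a' b' c' d'.
  by move=> *; move=> z [hz _]; apply/cdiff_ccont/df/(in_rect_sub _ _ _ _ hz).
suff : P a b c d by apply.
apply: rect_bisection => //.
  move=> a' b' c' d' ab' cd' P1 P2 P3 P4 aa' bb' cc' dd' _ _.
  have dfs' : forall u v p q, a' <= u -> v <= b' -> c' <= p -> q <= d' -> bd_cont f u v p q.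
    by move=> *; apply: dfs; lra.
  have [am mb cn nd] : [/\ a' <= (a' + b') / 2, (a' + b') / 2 <= b',
    c' <= (c' + d') / 2 & (c' + d') / 2 <= d'] by split; lra.
  have -> : eta * (b' - a' + (d' - c')) ^+ 2 =
     (eta * ((b' - a' + (d' - c')) / 2) ^+ 2) *+ 4 by field.
  rewrite (rint_splitx am mb cd'); [|exact: dfs'..].
  rewrite (rint_splity am cn nd); [|exact: dfs'..].
  rewrite (rint_splity mb cn nd); [|exact: dfs'..].
  rewrite -[4%N]/(2 + 2)%N mulrnDr (le_trans (ler_normcD _ _))//.
  apply: lerD; rewrite (le_trans (ler_normcD _ _))// mulr2n; apply: lerD.
  - by apply: le_trans (P1 _ _ _ _ _ _) _ => //; lra.
  - by apply: le_trans (P2 _ _ _ _ _ _) _ => //; lra.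
  - by apply: le_trans (P3 _ _ _ _ _ _) _ => //; lra.
  - by apply: le_trans (P4 _ _ _ _ _ _) _ => //; lra.
move=> x y /andP[ax xb] /andP[cy yd].
have [|D fD] := (derivableP_cderiv f (x +i* y)).1.
  by apply: df; split; apply/andP.
(* [eta / 4] absorbs the constant of [normc_rint_le]. With both sides below [r / 2], all points of
   the rectangle are within [r] of [x +i* y]. *)
have [r r0 Hr] := fD (eta / 4) (divr_gt0 eta0 (ltr0n _ 4)).
exists (r / 2) => [|a' b' c' d' /andP[ax' xb'] /andP[cy' yd'] br dr aa' bb' cc' dd' ab' cd'];
  first by rewrite divr_gt0.
pose z0 := x +i* y.
pose E z := f z - (f z0 + D * (z - z0)).
have cA z : cdiff (fun z => f z0 + D * (z - z0)) z.
  apply: cdiffD; first exact: cdiff_cst.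
  apply: cdiffM; first exact: cdiff_cst.
  by apply: cdiffB; [exact: cdiff_id|exact: cdiff_cst].
have fE : f = (fun z => E z + (f z0 + D * (z - z0))).
  by apply/funext => z; rewrite /E subrK.
have cE : bd_cont E a' b' c' d'.
  move=> z [hz _]; apply/cdiff_ccont; apply: cdiffB; last exact: cA.
  by apply/df/(in_rect_sub _ _ _ _ hz).
rewrite fE rintD//; last by move=> z _; exact: cdiff_ccont.
rewrite (_ : (fun z => f z0 + D * (z - z0)) = fun z => (f z0 - D * z0) + D * z); last first.
  by apply/funext => z; rewrite mulrBr addrA addrAC.
have cid k : bd_cont (fun z => k * z) a' b' c' d'.
  by move=> z _; apply: cdiff_ccont; apply: cdiffM; [exact: cdiff_cst|exact: cdiff_id].
rewrite rintD//; last by move=> z _; exact/cdiff_ccont/cdiff_cst.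
rewrite rint_cst// rintZ//; last by move=> z _; exact/cdiff_ccont/cdiff_id.
rewrite rint_id// mulr0 !addr0.
apply: le_trans (normc_rint_le (M := eta / 4 * (b' - a' + (d' - c'))) ab' cd' cE _) _; last
  first.
  by rewrite le_eqVlt; apply/orP; left; apply/eqP; field.
move=> z [hz _].
have zz0 : normc (z - z0) <= b' - a' + (d' - c').
  by apply: normc_in_rect => //; split; apply/andP.
have := Hr (z - z0); rewrite [x +i* y + _]addrC subrK => /(_ (le_lt_trans zz0 _)).
rewrite -/z0 => Hz; rewrite /E opprD addrA; apply: le_trans (Hz _) _; first by lra.
by rewrite ler_pM2l// divr_gt0.
Qed.

End cauchy.

(** * Cauchy's formula on rectangles *)

Section cauchy_formula.
Context {R : realType}.
Implicit Types (f g h : R[i] -> R[i]) (a b c d x y m e : R) (z w k : R[i]).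
Local Notation Re := (@complex.Re R).
Local Notation Im := (@complex.Im R).

(** Cutting along the sides of the small square removes two vertical and two horizontal strips; none
    contains the exceptional point, so Goursat's theorem kills each of them. *)
Lemma rint_punctured h a b c d x y e : 0 < e ->
  a <= x - e -> x + e <= b -> c <= y - e -> y + e <= d ->
  (forall z, z != x +i* y -> cdiff h z) ->
  rint h a b c d = rint h (x - e) (x + e) (y - e) (y + e).
Proof.
move=> e0 ax xb cy yd dh.
have cont a' b' c' d' : a' != x -> b' != x -> c' != y -> d' != y -> bd_cont h a' b' c' d'.
  move=> ha hb hc hd z [_ zbd]; apply/cdiff_ccont/dh; apply/negP => /eqP zE.
  by case: zbd; rewrite zE /= => /esym/eqP; apply/negP.
have zero a' b' c' d' : a' <= b' -> c' <= d' -> ~~ ((a' <= x <= b') && (c' <= y <= d')) ->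
    rint h a' b' c' d' = 0.
  move=> ab' cd' nxy; apply: goursat => // z [h1 h2]; apply: dh; apply/negP => /eqP zE.
  by move: nxy; rewrite zE /= in h1 h2; rewrite h1 h2.
have ne (u v : R) : u <= v - e \/ v + e <= u -> u != v.
  by move=> H; rewrite neq_lt; apply/orP; case: H => H; [left|right]; lra.
have nex : x - e != x /\ x + e != x by split; apply: ne; [left|right].
have ney : y - e != y /\ y + e != y by split; apply: ne; [left|right].
have nebd : [/\ a != x, b != x, c != y & d != y].
  by split; apply: ne; [left|right|left|right].
case: nex nebd ney => [x1 x2] [xa xb' yc yd'] [y1 y2].
have [ab1 ab2 cd1 cd2] : [/\ x - e <= b, x - e <= x + e, y - e <= d & y - e <= y + e] by
  split; lra.
have cd : c <= d by lra.
rewrite (rint_splitx ax ab1 cd); [|exact: cont..].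
rewrite (rint_splitx ab2 xb cd); [|exact: cont..].
rewrite (rint_splity ab2 cy cd1); [|exact: cont..].
rewrite (rint_splity ab2 cd2 yd); [|exact: cont..].
rewrite [rint h a _ _ _]zero//; last by apply/negP => /andP[/andP[? ?] _]; lra.
rewrite [rint h _ b _ _]zero//; last by apply/negP => /andP[/andP[? ?] _]; lra.
rewrite [rint h _ _ c _]zero//; last by apply/negP => /andP[_ /andP[? ?]]; lra.
rewrite [rint h _ _ _ d]zero//; last by apply/negP => /andP[_ /andP[? ?]]; lra.
by rewrite !add0r !addr0.
Qed.

(** Up to a factor ['i], this is the difference of the Cauchy kernel on two opposite edges of a
    square of half-side [e] centred at the pole. Its integral over an edge is
    [2 (atan 1 - atan (-1)) = pi], so each pair of edges contributes ['i * pi]. *)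
Definition lorentz e x (t : R) : R := 2 * e / ((t - x) ^+ 2 + e ^+ 2).

Lemma lorentz_derive e x t : 0 < e ->
  is_derive t (1 : R) (fun t : R => 2 * atan ((t - x) / e)) (lorentz e x t).
Proof.
move=> e0; have e1 : e != 0 by rewrite gt_eqF.
have h1 : is_derive t (1 : R) (fun t : R => (t - x) / e) e^-1.
  have -> : (fun t : R => (t - x) / e) = e^-1 \*: (fun t : R => t - x).
    by apply/funext => s /=; rewrite mulrC.
  by apply: is_derive_eq; rewrite subr0 scaler1.
have h2 := is_derive1_atan ((t - x) / e).
have h3 : is_derive t (1 : R) (atan \o (fun t : R => (t - x) / e)) ((1 + ((t - x) / e) ^+
  2)^-1 * e^-1).
  exact: is_derive1_comp.
have -> : (fun t : R => 2 * atan ((t - x) / e)) = 2 \*: (atan \o (fun t : R => (t - x) / e))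
  by [].
apply: is_derive_eq; rewrite /lorentz /GRing.scale/=.
have : 1 + ((t - x) / e) ^+ 2 != 0 by rewrite gt_eqF// ltr_pwDl// sqr_ge0.
have : (t - x) ^+ 2 + e ^+ 2 != 0 by rewrite gt_eqF// ltr_wpDl ?sqr_ge0// exprn_gt0.
by move=> n1 n2; field; rewrite n1 e1.
Qed.

Lemma lorentz_cont e x : 0 < e -> continuous (lorentz e x).
Proof.
move=> e0 t; apply: cvgM; first exact: cvg_cst.
apply: cvgV; first by rewrite gt_eqF// ltr_wpDl ?sqr_ge0// exprn_gt0.
apply: cvgD; last exact: cvg_cst.
by apply: (@continuous_comp _ _ _ (fun t : R => t - x) (fun t => t ^+ 2)); [apply: cvgB;
  [exact: cvg_id|exact: cvg_cst]|exact: exprn_continuous].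
Qed.

Lemma lorentz_integral e x : 0 < e ->
  \int[lebesgue_measure]_(t in `[x - e, x + e]) lorentz e x t = pi.
Proof.
move=> e0; rewrite /Rintegral.
have F' t := lorentz_derive x t e0.
have Fc : continuous (fun t : R => 2 * atan ((t - x) / e)).
  by move=> t; apply: differentiable_continuous; apply/derivable1_diffP; have [] := F' t.
rewrite (@continuous_FTC2 _ _ (fun t : R => 2 * atan ((t - x) / e))).
- have -> : (x + e - x) / e = 1 by rewrite addrAC subrr add0r divff// gt_eqF.
  have -> : (x - e - x) / e = - 1 by rewrite addrAC subrr add0r mulNr divff// gt_eqF.
  by rewrite /= atanN atan1; lra.
- by lra.
- by apply: continuous_subspaceT; exact: lorentz_cont.
- split; first by move=> t _; have [] := F' t.
    by apply: cvg_at_right_filter; exact: Fc.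
  by apply: cvg_at_left_filter; exact: Fc.
- by move=> t _; rewrite derive1E; have [] := F' t.
Qed.

Lemma rint_inv x y e : 0 < e ->
  rint (fun z => (z - (x +i* y))^-1) (x - e) (x + e) (y - e) (y + e) = 'i * (2 * pi)%:C.
Proof.
move=> e0; rewrite /rint.
have n0 (t s : R) : (t - s) ^+ 2 + e ^+ 2 != 0.
  by rewrite gt_eqF// ltr_wpDl ?sqr_ge0// exprn_gt0.
have n1 (t s : R) : e ^+ 2 + (t - s) ^+ 2 != 0 by rewrite addrC.
have -> : (fun x0 => (x0 +i* (y - e) - (x +i* y))^-1 - (x0 +i* (y + e) - (x +i* y))^-1) =
    (fun t => 0 +i* lorentz e x t).
  apply/funext => t; rewrite !complexB.
  rewrite [y - e - y]addrAC [y + e - y]addrAC subrr !add0r /lorentz.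
  apply/eqP; rewrite eq_complex /=; apply/andP; split; apply/eqP; field; rewrite ?sqrrN;
    exact: n0.
have -> : (fun y0 => ((x + e) +i* y0 - x +i* y)^-1 - ((x - e) +i* y0 - x +i* y)^-1) =
    (fun t => lorentz e y t +i* 0).
  apply/funext => t; rewrite !complexB.
  rewrite [x - e - x]addrAC [x + e - x]addrAC subrr !add0r /lorentz.
  apply/eqP; rewrite eq_complex /=; apply/andP; split; apply/eqP; field; rewrite ?sqrrN ?n0
    ?n1//.
have z0 (t0 : R) : \int[lebesgue_measure]_(t in `[t0 - e, t0 + e]) 0 = 0 :> R.
  by rewrite Rintegral_cst_itv ?mul0r//; lra.
rewrite (_ : cint (x - e) (x + e) _ = 0 +i* pi); last first.
  by congr Complex; [exact: z0|exact: lorentz_integral].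
rewrite (_ : cint (y - e) (y + e) _ = pi +i* 0); last first.
  by congr Complex; [exact: lorentz_integral|exact: z0].
by apply/eqP; rewrite eq_complex /=; apply/andP; split; apply/eqP; ring.
Qed.

Lemma square_bd_far w (s : R) (u : R[i]) : 0 < s -> on_bd (Re w - s) (Re w + s) (Im w - s)
  (Im w + s) u -> s <= normc (u - w).
Proof.
case: w => x y; case: u => u v /= s0 [_ /=] H.
have [H1|H1] : s = `|u - x| \/ s = `|v - y|.
- have aux (p q : R) : p = q - s \/ p = q + s -> s = `|p - q|.
    by case=> ->; rewrite addrAC subrr add0r ?normrN gtr0_norm.
  by case: H => H; [left|left|right|right]; apply: aux; [left|right|left|right].
- by rewrite {1}H1; exact: (Re_le_normc ((u - x) +i* (v - y))).
- by rewrite {1}H1; exact: (Im_le_normc ((u - x) +i* (v - y))).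
Qed.

(** On a small square around [z], replace [f u] by [f z + (f u - f z)]: the constant gives the main
    term by [rint_inv], and the difference quotient of the rest stays bounded by [1 + |D|] while the
    perimeter tends to 0. *)
Lemma cauchy_formula f a b c d z : entire f -> a < Re z < b -> c < Im z < d ->
  rint (fun u => f u * (u - z)^-1) a b c d = 'i * (2 * pi)%:C * f z.
Proof.
case: z => x y fE /= /andP[ax xb] /andP[cy yd]; pose z := x +i* y; rewrite -/z.
apply/eqP; rewrite -subr_eq0; apply/eqP/eq0_normc/eqP; rewrite eq_le normc_ge0 andbT.
have [D fD] := (derivableP_cderiv f z).1 (fE z).
have [r r0 Hr] := fD 1 ltr01.
pose M := 1 + normc D.
have M0 : 0 < M by rewrite ltr_pwDl// normc_ge0.
have dq g : entire g -> forall u, u != z -> cdiff (fun u => g u * (u - z)^-1) u.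
  move=> gE u uz; apply: cdiffM; first exact: gE.
  apply: cdiffV; first by rewrite subr_eq0.
  by apply: cdiffB; [exact: cdiff_id|exact: cdiff_cst].
apply/ler_addgt0Pl => eps eps0; rewrite addr0.
(* The first four terms keep the square inside the rectangle; [r / 5] puts its points, at distance
   at most [4 e] from [z], strictly within [r]; the last one makes the bound [4 * M * (4 e)] at most
   [eps]. *)
pose e := Num.min (Num.min (x - a) (b - x)) (Num.min (Num.min (y - c) (d - y)) (Num.min (r /
  5) (eps / (16 * M)))).
have e0 : 0 < e by rewrite /e !lt_min !subr_gt0 ax xb cy yd !divr_gt0// mulr_gt0.
have : e <= e by [].
rewrite {2}/e !le_min => /andP[/andP[xa bx]] /andP[/andP[yc dy]] /andP[er ee].
rewrite (rint_punctured (x := x) (y := y) e0); [|lra..|exact: dq].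
have ab : x - e <= x + e by lra.
have cd : y - e <= y + e by lra.
have bdne u : on_bd (x - e) (x + e) (y - e) (y + e) u -> u != z.
  move=> hu; rewrite -subr_eq0 -normc_gt0; apply: (lt_le_trans e0).
  exact: (@square_bd_far z e u e0 hu).
have bdc g : entire g -> bd_cont (fun u => g u * (u - z)^-1) (x - e) (x + e) (y - e) (y + e).
  by move=> gE u hu; apply/cdiff_ccont/dq => //; exact: bdne.
have gE : entire (fun u => f u - f z) by move=> u; apply: cdiffB; [exact: fE|exact: cdiff_cst].
have -> : (fun u => f u * (u - z)^-1) = (fun u => (f u - f z) * (u - z)^-1 + f z * (u - z)^-1).
  by apply/funext => u; rewrite -mulrDl subrK.
have bc1 : bd_cont (fun u => f z * (u - z)^-1) (x - e) (x + e) (y - e) (y + e).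
  by apply: (bdc (fun=> f z)) => u; exact: cdiff_cst.
have bc2 : bd_cont (fun u => (u - z)^-1) (x - e) (x + e) (y - e) (y + e).
  move=> u hu; have -> : (fun u => (u - z)^-1) = (fun u => 1 * (u - z)^-1) by apply/funext =>
    ?; rewrite mul1r.
  by apply: (bdc (fun=> 1)) hu => v; exact: cdiff_cst.
rewrite (rintD ab cd (bdc _ gE) bc1).
rewrite [X in _ + X - _](rintZ ab cd bc2) rint_inv// [f z * _]mulrC addrK.
apply: (le_trans (normc_rint_le (M := M) ab cd (bdc _ gE) _)); last first.
  have -> : 4 * M * (x + e - (x - e) + (y + e - (y - e))) = e * (16 * M) by ring.
  by rewrite -ler_pdivlMr// mulr_gt0.
move=> u hu; have uz := bdne u hu.
rewrite normcM normcV ler_pdivrMr ?normc_gt0 ?subr_eq0//.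
have ur : normc (u - z) < r.
  apply: (@le_lt_trans _ _ (x + e - (x - e) + (y + e - (y - e)))); last by lra.
  apply: normc_in_rect; first by case: hu.
  by split => /=; apply/andP; split; lra.
have := Hr _ ur; rewrite [z + _]addrC subrK => H.
rewrite -[f u - f z](subrK (D * (u - z))) (le_trans (ler_normcD _ _))// normcM /M mulrDl.
by rewrite lerD2r.
Qed.

End cauchy_formula.

(** * Cauchy's estimates on squares *)

Section cauchy_estimates.
Context {R : realType}.
Implicit Types (f g h : R[i] -> R[i]) (x y e s M : R) (z w k u : R[i]).
Local Notation Re := (@complex.Re R).
Local Notation Im := (@complex.Im R).

Lemma ccontB f g z : ccont f z -> ccont g z -> ccont (fun u => f u - g u) z.
Proof.
move=> fc gc e e0; have e2 : 0 < e / 2 by rewrite divr_gt0.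
have [r1 r10 H1] := fc _ e2; have [r2 r20 H2] := gc _ e2.
exists (Num.min r1 r2) => [|h]; first by rewrite lt_min r10.
rewrite lt_min => /andP[/H1 h1 /H2 h2].
have -> : f (z + h) - g (z + h) - (f z - g z) = (f (z + h) - f z) - (g (z + h) - g z) by ring.
by rewrite (splitr e) (le_trans (ler_normcD _ _))// lerD// normcN.
Qed.

Lemma bd_contB f g a b c d : bd_cont f a b c d -> bd_cont g a b c d ->
  bd_cont (fun u => f u - g u) a b c d.
Proof. by move=> fc gc z hz; apply: ccontB; [exact: fc|exact: gc]. Qed.

Lemma rintB f g (a b c d : R) : a <= b -> c <= d -> bd_cont f a b c d -> bd_cont g a b c d ->
  rint (fun u => f u - g u) a b c d = rint f a b c d - rint g a b c d.
Proof.
move=> ab cd fc gc; have := rintD ab cd (bd_contB fc gc) gc.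
have -> : (fun u => f u - g u + g u) = f by apply/funext => u; rewrite subrK.
by move=> ->; rewrite addrK.
Qed.

Local Notation sq w s := (on_bd (Re w - s) (Re w + s) (Im w - s) (Im w + s)).

Lemma cauchy_square_le g w s (N : R) : 0 < s ->
  bd_cont g (Re w - s) (Re w + s) (Im w - s) (Im w + s) ->
  (forall u, sq w s u -> normc (g u) <= N) ->
  normc (('i * (2 * pi)%:C)^-1 * rint g (Re w - s) (Re w + s) (Im w - s) (Im w + s)) <=
    16 * N * s.
Proof.
move=> s0 gc gN; rewrite normcM normcV normcM normcR.
have -> : normc ('i : R[i]) = 1 by rewrite /= expr0n/= add0r expr1n sqrtr1.
have := pi_ge2 R => pi2.
have c1 : 1 <= `|2 * pi : R| by rewrite ger0_norm; lra.
rewrite mul1r.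
have := @normc_rint_le _ g (Re w - s) (Re w + s) (Im w - s) (Im w + s) _ _ gc N gN.
have -> : 4 * N * (Re w + s - (Re w - s) + (Im w + s - (Im w - s))) = 16 * N * s by ring.
move=> H; apply: le_trans (H _ _); [|lra..].
by rewrite ler_piMl ?normc_ge0// invf_le1// (lt_le_trans ltr01).
Qed.

(** Subtracting Cauchy integrals leaves the kernels [(z - w) / ((u - z) (u - w))] and, to second
    order, [(z - w)^2 / ((u - z) (u - w)^2)]. On the contour [|u - w| >= s] and [|u - z| >= s / 2];
    hence 32, which is the 16 of [cauchy_square_le] times 2. The number [D] is the Cauchy integral
    with kernel [(u - w)^-2], and the quadratic remainder itself shows that it is the derivative. *)
Lemma cauchy_estimates f w s M : entire f -> 0 < s ->
  (forall u, sq w s u -> normc (f u) <= M) ->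
  exists D, [/\ cderiv f w D, normc D <= 32 * M / s,
    forall z, normc (z - w) <= s / 2 ->
      normc (f z - f w) <= 32 * M * normc (z - w) / s &
    forall z, normc (z - w) <= s / 2 ->
      normc (f z - f w - D * (z - w)) <= 32 * M * normc (z - w) ^+ 2 / s ^+ 2].
Proof.
move=> fE s0 fM.
pose a := Re w - s; pose b := Re w + s; pose c := Im w - s; pose d := Im w + s.
have ab : a <= b by rewrite /a/b; lra.
have cd : c <= d by rewrite /c/d; lra.
pose c0 : R[i] := 'i * (2 * pi)%:C.
have c00 : c0 != 0.
  rewrite -normc_gt0 normcM normcR.
  have -> : normc ('i : R[i]) = 1 by rewrite /= expr0n/= add0r expr1n sqrtr1.
  by rewrite mul1r normr_gt0 mulf_neq0// gt_eqF// pi_gt0.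
have bne u : sq w s u -> u - w != 0 by move=> /(square_bd_far s0) H; rewrite -normc_gt0
  (lt_le_trans s0).
have M0 : 0 <= M.
  apply: le_trans (normc_ge0 _) (fM (a +i* c) _).
  by split => /=; [split => /=; rewrite lexx|constructor 1].
have zfar z u : normc (z - w) <= s / 2 -> sq w s u -> s / 2 <= normc (u - z).
  move=> zw /(square_bd_far s0) uw.
  have : normc (u - w) <= normc (u - z) + normc (z - w) by rewrite (le_trans _ (ler_normcD _
    _))// subrKA.
  lra.
have bnez z u : normc (z - w) <= s / 2 -> sq w s u -> u - z != 0.
  by move=> zw /(zfar _ _ zw) H; rewrite -normc_gt0 (lt_le_trans _ H)// divr_gt0.
have repr z : normc (z - w) <= s / 2 -> f z = c0^-1 * rint (fun u => f u * (u - z)^-1) a b c d.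
  move=> zw; rewrite cauchy_formula//; first by rewrite mulKf.
    rewrite /a /b; have := le_trans (Re_le_normc _) zw; rewrite raddfB/= ler_norml => /andP[?
      ?]; lra.
  rewrite /c /d; have := le_trans (Im_le_normc _) zw; rewrite raddfB/= ler_norml => /andP[?
    ?]; lra.
have ww : normc (w - w) <= s / 2 by rewrite subrr normc0 divr_ge0// ltW.
have dinv z u : u - z != 0 -> cdiff (fun u => (u - z)^-1) u.
  by move=> uz; apply: cdiffV => //; apply: cdiffB; [exact: cdiff_id|exact: cdiff_cst].
have bcz z : normc (z - w) <= s / 2 -> bd_cont (fun u => f u * (u - z)^-1) a b c d.
  move=> zw u hu; apply/cdiff_ccont/cdiffM; first exact: fE.
  by apply: dinv; exact: bnez hu.
have bc2 : bd_cont (fun u => f u * ((u - w)^-1 * (u - w)^-1)) a b c d.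
  move=> u hu; apply/cdiff_ccont/cdiffM; first exact: fE.
  by apply: cdiffM; apply: dinv; exact: bne hu.
pose D := c0^-1 * rint (fun u => f u * ((u - w)^-1 * (u - w)^-1)) a b c d.
have first_order z : normc (z - w) <= s / 2 ->
    normc (f z - f w) <= 32 * M * normc (z - w) / s.
  move=> zw; rewrite (repr _ zw) (repr _ ww) -mulrBr.
  rewrite -(rintB ab cd (bcz _ zw) (bcz _ ww)).
  have bc := bd_contB (bcz _ zw) (bcz _ ww).
  apply: le_trans (cauchy_square_le (N := M * (normc (z - w) * (2 / s ^+ 2))) s0 bc _) _;
    last first.
    by rewrite le_eqVlt; apply/orP; left; apply/eqP; field; rewrite gt_eqF.
  move=> u hu.
  have -> : f u / (u - z) - f u / (u - w) = f u * ((z - w) * ((u - z)^-1 * (u - w)^-1)).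
    by field; rewrite bne// bnez.
  rewrite !normcM !normcV; apply: ler_pM; rewrite ?normc_ge0 ?mulr_ge0 ?invr_ge0
    ?normc_ge0//; first exact: fM.
  apply: ler_wpM2l; first exact: normc_ge0.
  have -> : 2 / s ^+ 2 = (s / 2)^-1 * s^-1 by field; rewrite gt_eqF.
  apply: ler_pM; rewrite ?invr_ge0 ?normc_ge0// lef_pV2 ?posrE ?normc_gt0 ?divr_gt0//.
  - exact: zfar.
  - exact: bnez hu.
  - exact: square_bd_far.
  - exact: bne.
have second_order z : normc (z - w) <= s / 2 ->
    normc (f z - f w - D * (z - w)) <= 32 * M * normc (z - w) ^+ 2 / s ^+ 2.
  move=> zw; rewrite (repr _ zw) (repr _ ww) /D -mulrBr -mulrA -mulrBr.
  rewrite -(rintB ab cd (bcz _ zw) (bcz _ ww)).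
  have bc := bd_contB (bcz _ zw) (bcz _ ww).
  rewrite [rint _ _ _ _ _ * (z - w)]mulrC -(rintZ ab cd bc2).
  have bc3 : bd_cont (fun u => (z - w) * (f u * ((u - w)^-1 * (u - w)^-1))) a b c d.
    move=> u hu; apply/cdiff_ccont/cdiffM; first exact: cdiff_cst.
    by apply: cdiffM; [exact: fE|apply: cdiffM; apply: dinv; exact: bne hu].
  rewrite -(rintB ab cd bc bc3).
  have bc' := bd_contB bc bc3.
  apply: le_trans (cauchy_square_le (N := M * (normc (z - w) * normc (z - w) * (2 / s ^+ 3)))
    s0 bc' _) _; last first.
    by rewrite le_eqVlt; apply/orP; left; apply/eqP; field; rewrite gt_eqF.
  move=> u hu.
  have -> : f u / (u - z) - f u / (u - w) - ((z - w) * (f u * ((u - w)^-1 / (u - w))))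
     = f u * ((z - w) * (z - w) * ((u - z)^-1 * ((u - w)^-1 * (u - w)^-1))).
    by field; rewrite bne// bnez.
  have inv_ge0 (v : R[i]) : 0 <= (normc v)^-1 by rewrite invr_ge0 normc_ge0.
  rewrite !normcM !normcV; apply: ler_pM; rewrite ?normc_ge0 ?mulr_ge0 ?exprn_ge0
    ?normc_ge0//; first exact: fM.
  apply: ler_wpM2l; first by rewrite mulr_ge0 ?normc_ge0.
  have -> : 2 / s ^+ 3 = (s / 2)^-1 * (s^-1 * s^-1) by field; rewrite gt_eqF.
  have wV : (normc (u - w))^-1 <= s^-1.
    by rewrite lef_pV2 ?posrE ?normc_gt0 ?bne//; exact: square_bd_far.
  apply: ler_pM; rewrite ?mulr_ge0//; last by apply: ler_pM.
  by rewrite lef_pV2 ?posrE ?normc_gt0 ?divr_gt0 ?(bnez _ _ zw hu)//; exact: zfar.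
exists D; split => //.
  move=> e e0; pose K := 32 * M / s ^+ 2 + 1.
  have K0 : 0 < K by rewrite ltr_wpDl// mulr_ge0 ?mulr_ge0// invr_ge0 sqr_ge0.
  exists (Num.min (s / 2) (e / K)) => [|h]; first by rewrite lt_min !divr_gt0.
  rewrite lt_min => /andP[hs he].
  have := second_order (w + h); rewrite [w + h]addrC addrK => /(_ (ltW hs)) H.
  apply: (le_trans H); rewrite expr2 mulrA mulrAC ler_wpM2r ?normc_ge0//.
  have -> : 32 * M * normc h / s ^+ 2 = 32 * M / s ^+ 2 * normc h by rewrite mulrAC.
  move: he; rewrite ltr_pdivlMr// => he.
  apply: le_trans _ (ltW he); rewrite mulrC ler_wpM2l ?normc_ge0// /K lerDl//.
apply: le_trans (cauchy_square_le (N := M * (s^-1 * s^-1)) s0 bc2 _) _.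
  move=> u hu; rewrite !normcM !normcV.
  have wV : (normc (u - w))^-1 <= s^-1.
    by rewrite lef_pV2 ?posrE ?normc_gt0 ?bne//; exact: square_bd_far.
  have inv_ge0 (v : R[i]) : 0 <= (normc v)^-1 by rewrite invr_ge0 normc_ge0.
  apply: ler_pM; rewrite ?normc_ge0 ?mulr_ge0//; first exact: fM.
  exact: ler_pM.
rewrite (_ : 16 * _ * s = 16 * M / s); last by field; rewrite gt_eqF.
by rewrite ler_pM2r ?invr_gt0//; lra.
Qed.

End cauchy_estimates.

(** * Sub-mean value estimates *)

Section plane_measure.
Context {R : realType}.
Local Notation mR := (measurableTypeR R).
Local Notation leb := (@lebesgue_measure R).
Local Notation leb2 := (@lebesgue_measure R \x @lebesgue_measure R)%E.
Implicit Types (f : R[i] -> R[i]) (w z : R[i]) (F : R * R -> R) (r : R).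

Definition square (x y r : R) : set (mR * mR) :=
  `[x - r, x + r] `*` `[y - r, y + r].

Lemma measurable_square x y r : measurable (square x y r).
Proof. by apply: measurableX; exact: measurable_itv. Qed.

Lemma square_subset x y r x' y' r' : `|x - x'| <= r' - r -> `|y - y'| <= r' - r ->
  square x y r `<=` square x' y' r'.
Proof.
rewrite !ler_distl => /andP[x1 x2] /andP[y1 y2] v [/=].
rewrite !in_itv/= => /andP[a1 a2] /andP[b1 b2].
by split; rewrite /= in_itv/=; apply/andP; split; lra.
Qed.

(** The sigma-algebra on pairs is the product one, so open sets must be reached from rectangles: an
    open set is the countable union of the squares with rational centre and radius [1 / (n + 1)]
    that it contains. *)
Lemma continuous2_measurable F : continuous F ->
  measurable_fun (setT : set (mR * mR)) (F : mR * mR -> mR).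
Proof.
move=> cF mD; apply: (measurability _ (measurable_realfun.RGenOInfty.measurableE R)) => //.
move=> _ [_ [a ->] <-]; rewrite setTI.
set U := _ @^-1` _.
have oU : open U by apply: open_comp => // x _; exact: cF.
pose rad (n : nat) : R := n.+1%:R^-1.
have rad0 n : 0 < rad n by rewrite invr_gt0.
pose B (p q : rat) n : set (mR * mR) := 
  if pselect (square (ratr p) (ratr q) (rad n) `<=` U) then square (ratr p) (ratr q) (rad n)
    else set0.
have -> : U = \bigcup_p \bigcup_q \bigcup_n B p q n.
  rewrite eqEsubset; split => [[x y] Uxy|v [p _ [q _ [n _]]]]; last first.
    by rewrite /B; case: pselect => //= sU; exact: sU.
  have [e /= e0 eU] := (nbhs_ballP _ _).1 (open_nbhs_nbhs (conj oU Uxy)).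
  have [n hn] : exists n, rad n < e / 2.
    have e2 : 0 < e / 2 by rewrite divr_gt0.
    exists (Num.bound (e / 2)^-1); rewrite /rad invf_plt ?posrE//.
    apply: (lt_le_trans (archi_boundP _)); first by rewrite invr_ge0 ltW.
    by rewrite ler_nat.
  have sh (t : R) : t < t + rad n by rewrite ltrDl.
  have [p hp] := rat_in_itvoo (sh x).
  have [q hq] := rat_in_itvoo (sh y).
  move: hp hq; rewrite !in_itv/= => /andP[p1 p2] /andP[q1 q2].
  exists p => //; exists q => //; exists n => //; rewrite /B.
  case: pselect => [sU|nsU] /=.
    by split => /=; rewrite in_itv/=; apply/andP; split; lra.
  exfalso; apply: nsU => -[u v] [/=]; rewrite !in_itv/= => /andP[u1 u2] /andP[v1 v2]; apply:
    eU; split => /=.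
    by rewrite /ball/= ltr_norml; apply/andP; split; lra.
  by rewrite /ball/= ltr_norml; apply/andP; split; lra.
apply: bigcupT_measurable_rat => p; apply: bigcupT_measurable_rat => q.
apply: bigcupT_measurable => n; rewrite /B; case: pselect => ? /=; last exact: measurable0.
exact: measurable_square.
Qed.

Lemma leb2_square x y r : 0 <= r -> leb2 (square x y r) = ((2 * r) ^+ 2)%:E.
Proof.
move=> r0; rewrite product_measure1E; [|exact: measurable_itv..].
have H t : leb `[t - r, t + r] = (2 * r)%:E.
  rewrite lebesgue_measure_itv/= lte_fin; case: ifPn => [_|]; first by rewrite -EFinB; congr
    EFin; ring.
  by rewrite -leNgt => h; congr EFin; lra.
by rewrite /= !H -EFinM.
Qed.

Lemma integral_square_ge (g : mR * mR -> R) x y r (D : set (mR * mR)) (m : R) :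
  0 <= r -> measurable D -> square x y r `<=` D -> measurable_fun setT g ->
  0 <= m -> (forall v, 0 <= g v) -> (forall v, square x y r v -> m <= g v) ->
  ((m * (2 * r) ^+ 2)%:E <= \int[leb2]_(v in D) (g v)%:E)%E.
Proof.
move=> r0 mD sD mg m0 g0 gm.
have mg' A : measurable_fun A (EFin \o g).
  by apply/measurable_EFinP; exact: measurable_funTS.
apply: (@le_trans _ _ (\int[leb2]_(v in square x y r) (g v)%:E)%E); last first.
  have := @ge0_subset_integral _ _ R leb2 _ _ (measurable_square x y r) mD _ (mg' D).
  by apply => // v _; rewrite lee_fin.
rewrite EFinM -(leb2_square x y r0) -integral_cst; last exact: measurable_square.
apply: ge0_le_integral => //; first exact: measurable_square.
Qed.

End plane_measure.

Section local_area_estimate.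
Context {R : realType}.
Local Notation leb2 := (@lebesgue_measure R \x @lebesgue_measure R)%E.
Implicit Types (f : R[i] -> R[i]) (w z : R[i]) (F : R * R -> R) (r : R).
Local Notation Re := (@complex.Re R).
Local Notation Im := (@complex.Im R).
Local Notation cx v := (v.1 +i* v.2).

Lemma cdiff_normc_continuous f : (forall z, cdiff f z) ->
  continuous (fun v : R * R => normc (f (cx v))).
Proof.
move=> fE v; apply/cvgrPdist_le => /= e e0.
have [r r0 H] := cdiff_ccont (fE (cx v)) e0.
apply/(@nbhs_ballP R (R * R)%type v); exists (r / 2) => /=; first by rewrite divr_gt0.
move=> u [/=]; rewrite /ball/= => h1 h2.
have uv : normc ((u.1 - v.1) +i* (u.2 - v.2)) < r.
  rewrite (le_lt_trans (normc_le_ReIm _))//= (splitr r).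
  by rewrite ltrD// distrC.
have := H _ uv; rewrite complexD !subrKC => {}H.
rewrite ler_norml; apply/andP; split.
  have := ler_normcD (f (cx u) - f (cx v)) (f (cx v)); rewrite subrK; lra.
have := ler_normcD (f (cx v) - f (cx u)) (f (cx u)); rewrite subrK normcB; lra.
Qed.

Lemma cdiff_normc_measurable f : (forall z, cdiff f z) ->
  measurable_fun setT (fun v : measurableTypeR R * measurableTypeR R => normc (f (cx v))).
Proof. by move=> /cdiff_normc_continuous; exact: continuous2_measurable. Qed.

(** The maximized function is [psi], where [de] measures the distance to the boundary of the unit
    square around [w] in the sup norm of [R * R]. Moving by at most [delta / 2] from the maximizer
    keeps [de] above [delta / 2], which costs [2 ^ k]. The powers of [delta] are not cancelled
    because [delta] may be 0 when [f] vanishes on the square. *)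
Lemma square_maximizer f w (k : nat) : entire f -> (0 < k)%N ->
  exists z0 delta, [/\ 0 <= delta <= 1,
    normc (f w) <= normc (f z0) * delta ^+ k,
    `|Re z0 - Re w| <= 1 - delta, `|Im z0 - Im w| <= 1 - delta &
    forall z, `|Re z - Re z0| <= delta / 2 -> `|Im z - Im z0| <= delta / 2 ->
      normc (f z) * delta ^+ k <= 2 ^+ k * (normc (f z0) * delta ^+ k)].
Proof.
move=> fE k0.
pose w0 : R * R := (Re w, Im w).
pose de (v : R * R) : R := 1 - `|v - w0|.
pose psi v := normc (f (cx v)) * de v ^+ k.
have psic : continuous psi.
  move=> v; apply: cvgM; first exact: cdiff_normc_continuous.
  apply: (@continuous_comp _ _ _ de (fun t => t ^+ k)); last exact: exprn_continuous.
  apply: cvgB; first exact: cvg_cst.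
  by apply: cvg_norm; apply: cvgB; [exact: cvg_id|exact: cvg_cst].
pose K : set (R * R) := `[Re w - 1, Re w + 1] `*` `[Im w - 1, Im w + 1].
have inK v : K v <-> `|v - w0| <= 1.
  rewrite /K /= !in_itv /= prod_normE ge_max /= !ler_norml.
  split=> [[/andP[? ?] /andP[? ?]]|/andP[/andP[? ?] /andP[? ?]]].
    by apply/andP; split; apply/andP; split; lra.
  by split; apply/andP; split; lra.
have [|||v0 Kv0 max0] := @compact_EVT_max _ _ psi K.
- by exists w0; apply/inK; rewrite subrr normr0.
- by apply: compact_setX; exact: segment_compact.
- exact: continuous_subspaceT.
have {}max0 v : K v -> psi v <= psi v0 by move=> Kv; apply: max0; rewrite inE.
have {}Kv0 : `|v0 - w0| <= 1 by apply/inK; move: Kv0; rewrite inE.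
exists (cx v0), (de v0); have d0 : 0 <= de v0 by rewrite subr_ge0.
have [h1 h2] : `|v0.1 - Re w| <= `|v0 - w0| /\ `|v0.2 - Im w| <= `|v0 - w0|.
  by rewrite prod_normE; split; rewrite le_max lexx ?orbT.
split.
- by apply/andP; split => //; have := normr_ge0 (v0.1 - Re w); rewrite /de; lra.
- have := max0 w0; rewrite inK subrr normr0 => /(_ ler01).
  rewrite /psi {1}/de subrr normr0 subr0 expr1n mulr1 /=.
  by have -> : Re w +i* Im w = w by case: (w).
- by rewrite /de subKr.
- by rewrite /de subKr.
move=> [x y] /= hx hy; pose v : R * R := (x, y).
have vv0 : `|v - v0| <= de v0 / 2 by rewrite prod_normE ge_max /= hx hy.
have dv : de v0 / 2 <= de v.
  have := ler_distD v0 v w0; rewrite /de in vv0 *; lra.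
have Kv : K v by apply/inK; move: dv; rewrite /de in d0 *; lra.
have := max0 _ Kv; rewrite -/(psi v0) => H.
rewrite -(ler_pM2l (exprn_gt0 k (_ : 0 < 2^-1 :> R))) ?invr_gt0//.
rewrite [leRHS]mulrA -exprMn mulVf ?pnatr_eq0// expr1n mul1r.
apply: le_trans H; rewrite mulrCA -exprMn ler_wpM2l ?normc_ge0//.
by rewrite lerXn2r// ?nnegrE ?mulr_ge0// 1?mulrC//; rewrite (le_trans _ dv)// divr_ge0.
Qed.

(* Maximizing [|f|] times a power of the distance to the boundary gives a point
   [z0] around which, at the scale [delta] of that distance, [|f|] is at most
   [2 ^ k |f z0|]; by Cauchy's estimates [|f| >= |f z0| / 2] on a smaller square of
   the same scale.  This works for all exponents, in particular for [p < 1]. *)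
Lemma local_area_estimate (p : R) : 0 < p -> exists2 C : R, 0 < C &
  forall f w, entire f ->
    ((normc (f w) `^ p)%:E <=
     C%:E * \int[leb2]_(v in square (Re w) (Im w) 1) (normc (f (cx v)) `^ p)%:E)%E.
Proof.
move=> p0.
(* With [k p >= 2] and [d <= 1], the factor [d ^ (k p)] in the bound of [|f w| ^ p] is at most
   [d ^ 2], the order of the area of the small square. *)
have [k k0 kp] : exists2 k : nat, (0 < k)%N & 2 <= k%:R * p.
  exists (Num.bound (2 / p)).+1 => //; rewrite -ler_pdivrMr//.
  by apply: (le_trans (ltW (archi_boundP _))); rewrite ?ler_nat// divr_ge0// ltW.
(* Chosen so that the first-order Cauchy estimate with half-side [d / 2], bound [2 ^ k A] and
   displacement [2 c d] gives exactly [A / 2]. *)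
pose c : R := (256 * 2 ^+ k)^-1.
have k1 : 1 <= 2 ^+ k :> R by rewrite exprn_ege1// ler1n.
have c0 : 0 < c by rewrite invr_gt0; lra.
have c4 : c <= 8^-1 by rewrite /c lef_pV2 ?posrE; lra.
exists (2 `^ p / (2 * c) ^+ 2).
  by rewrite divr_gt0 ?powR_gt0// exprn_gt0// mulr_gt0.
move=> f w fE.
have g0 v : 0 <= normc (f (cx v)) `^ p by exact: powR_ge0.
have gm : measurable_fun setT (fun v : measurableTypeR R * measurableTypeR R => normc (f (cx
  v)) `^ p).
  by apply: measurableT_comp (measurable_powR p) _; exact: cdiff_normc_measurable.
have [fw0|fw0] := eqVneq (f w) 0.
  rewrite fw0 normc0 powR0 ?gt_eqF//.
  apply: mule_ge0; first by rewrite lee_fin mulr_ge0 ?powR_ge0// invr_ge0 sqr_ge0.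
  by apply: integral_ge0 => v _; rewrite lee_fin.
have [z0 [d [/andP[d0 d1] fd hRe hIm hmax]]] := square_maximizer w fE k0.
have fwgt : 0 < normc (f w) by rewrite normc_gt0.
have d0' : 0 < d.
  rewrite lt_def d0 andbT; apply: contraTneq (lt_le_trans fwgt fd) => ->.
  by rewrite expr0n gtn_eqF// mulr0 ltxx.
pose A := normc (f z0).
have A0 : 0 < A by have := lt_le_trans fwgt fd; rewrite pmulr_lgt0// exprn_gt0.
have fM u : on_bd (Re z0 - d / 2) (Re z0 + d / 2) (Im z0 - d / 2) (Im z0 + d / 2) u ->
    normc (f u) <= 2 ^+ k * A.
  move=> [[/andP[h1 h2] /andP[h3 h4]] _].
  have := hmax u; rewrite mulrA ler_pM2r ?exprn_gt0//.
  by apply; rewrite ler_distl ?h1 ?h3.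
have [D [_ _ H _]] := cauchy_estimates fE (divr_gt0 d0' (ltr0n _ 2)) fM.
have cd8 : c * d <= d / 8 by rewrite mulrC ler_pM2l.
have near v : square (Re z0) (Im z0) (c * d) v -> A / 2 <= normc (f (cx v)).
  move=> [/=]; rewrite !in_itv /= => /andP[a1 a2] /andP[b1 b2].
  have vz : normc (cx v - z0) <= 2 * (c * d).
    rewrite (le_trans (normc_le_ReIm _))// mulr2n mulrDl mul1r !raddfB /=.
    by apply: lerD; rewrite ler_distl ?a1 ?b1.
  have {}H := H (cx v); have {}H := H (le_trans vz _); have {}H : normc (f (cx v) - f z0) <=
    A / 2.
    apply: le_trans (H _) _; first lra.
    have -> : A / 2 = 32 * (2 ^+ k * A) * (2 * (c * d)) / (d / 2).
      rewrite /c; field; rewrite ?gt_eqF// ?mulr_gt0 ?exprn_gt0//.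
    by rewrite ler_pM2r ?invr_gt0 ?divr_gt0// ler_pM2l// !mulr_gt0// exprn_gt0.
  have := ler_normcD (f z0 - f (cx v)) (f (cx v)); rewrite subrK normcB -/A; lra.
have cd0 : 0 <= c * d by rewrite mulr_ge0// ltW.
have sub : square (Re z0) (Im z0) (c * d) `<=` square (Re w) (Im w) 1.
  have cd1 : 1 - d <= 1 - c * d.
    by rewrite lerD2l lerN2 ler_piMl// (le_trans c4)// invf_le1// ler1n.
  by apply: square_subset; [exact: le_trans hRe cd1|exact: le_trans hIm cd1].
have := @integral_square_ge _ _ (Re z0) (Im z0) (c * d) _ ((A / 2) `^ p) cd0
  (measurable_square _ _ _) sub gm (powR_ge0 _ _) g0 _.
have h v : square (Re z0) (Im z0) (c * d) v -> (A / 2) `^ p <= normc (f (cx v)) `^ p.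
  by move=> /near Hv; apply: ge0_ler_powR; rewrite ?nnegrE ?normc_ge0 ?divr_ge0// ltW.
move=> /(_ h) I.
apply: (@le_trans _ _ ((2 `^ p / (2 * c) ^+ 2)%:E * ((A / 2) `^ p * (2 * (c * d)) ^+
  2)%:E)%E); last first.
  by apply: lee_wpmul2l => //; rewrite lee_fin mulr_ge0 ?powR_ge0// invr_ge0 sqr_ge0.
rewrite -EFinM lee_fin.
apply: (@le_trans _ _ ((A * d ^+ k) `^ p)).
  by apply: ge0_ler_powR; rewrite ?nnegrE ?normc_ge0 ?mulr_ge0 ?exprn_ge0// ltW.
rewrite powRM ?exprn_ge0 ?(ltW A0)//.
have -> : 2 `^ p / (2 * c) ^+ 2 * ((A / 2) `^ p * (2 * (c * d)) ^+ 2) = (2 * (A / 2)) `^ p *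
  d ^+ 2.
  rewrite (@powRM _ 2) ?divr_ge0 ?(ltW A0)//; field; rewrite gt_eqF//.
have -> : 2 * (A / 2) = A by field.
rewrite ler_wpM2l ?powR_ge0//.
rewrite -powR_mulrn// -powRrM -[leRHS]powR_mulrn//; apply: ger_powR => //.
by rewrite d0'.
Qed.

End local_area_estimate.

(** * The complex exponential as an entire function *)

Section complex_exponential.
Context {R : realType}.
Implicit Types (z w k h : R[i]).
Local Notation Re := (@complex.Re R).
Local Notation Im := (@complex.Im R).

Lemma is_derive_first_order (F : R -> R) (x D : R) : is_derive x (1 : R) F D ->
  forall e : R, 0 < e -> exists2 r : R, 0 < r &
  forall h : R, `|h| < r -> `|F (x + h) - F x - D * h| <= e * `|h|.
Proof.
move=> [/cvg_ex[l /= Fl] <-] e e0.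
have lE : 'D_1 F x = l by apply: (cvg_lim _ Fl).
have := Fl (ball l e) (nbhsx_ballx l e e0).
rewrite /nbhs/=/dnbhs/within/= => /nbhs_ballP[r /= r0 H].
exists r => // h hr; have [->|h0] := eqVneq h 0.
  by rewrite addr0 subrr mulr0 subrr normr0 mulr0.
have := H h; rewrite /ball /= sub0r normrN => /(_ hr h0).
rewrite lE => {}H; rewrite -ler_pdivrMr ?normr_gt0// -normf_div.
apply/ltW; move: H; rewrite distrC; congr (`|_| < e).
rewrite mulrBl mulfK//; congr (_ - _).
by rewrite [h *: _]mulr1 /= [h + x]addrC [_ *: _]/(_ * _) mulrC.
Qed.

Definition cexp z : R[i] := (expR (Re z) * cos (Im z)) +i* (expR (Re z) * sin (Im z)).

Lemma cexpD z w : cexp (z + w) = cexp z * cexp w.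
Proof.
rewrite /cexp Re_addc Im_addc expRD cosD sinD; apply/eqP; rewrite eq_complex /=.
by apply/andP; split; apply/eqP; ring.
Qed.

Lemma normc_cexp z : normc (cexp z) = expR (Re z).
Proof.
rewrite /= !exprMn -mulrDr cos2Dsin2 mulr1 sqrtr_sqr ger0_norm//.
Qed.

Lemma cexp_first_order e : 0 < e -> exists2 r : R, 0 < r &
  forall h, normc h < r -> normc (cexp h - 1 - h) <= e * normc h.
Proof.
move=> e0; have e8 : 0 < e / 8 by rewrite divr_gt0.
have [r1 r10 He] := is_derive_first_order (is_derive_expR 0) e8.
have [r2 r20 Hc] := is_derive_first_order (is_derive_cos 0) e8.
have [r3 r30 Hs] := is_derive_first_order (is_derive_sin 0) e8.
have [r4 r40 H1] := is_derive_first_order (is_derive_expR 0) ltr01.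
(* [r4] and [1 / 2] give [expR (Re h) <= 2]; the last [e / 8] controls the product of [Im h] and
   [expR (Re h) - 1]. The four errors add up to [7 e / 8]. *)
exists (Num.min (Num.min r1 r2) (Num.min (Num.min r3 r4) (Num.min (1 / 2) (e / 8)))).
  by rewrite !lt_min r10 r20 r30 r40 e8 divr_gt0.
move=> h; rewrite !lt_min => /andP[/andP[h1 h2]] /andP[/andP[h3 h4]] /andP[h5 h6].
have ha := Re_le_normc h; have hb := Im_le_normc h.
have {}He := He (Re h) (le_lt_trans ha h1).
have {}Hc := Hc (Im h) (le_lt_trans hb h2).
have {}Hs := Hs (Im h) (le_lt_trans hb h3).
have {}H1 := H1 (Re h) (le_lt_trans ha h4).
rewrite !add0r expR0 cos0 sin0 ?oppr0 ?mul0r ?mul1r ?subr0 ?addr0 in He Hc Hs H1.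
rewrite (le_trans (normc_le_ReIm _))//.
have -> : Re (cexp h - 1 - h) = (expR (Re h) - 1 - Re h) + expR (Re h) * (cos (Im h) - 1).
  by rewrite !raddfB /=; ring.
have -> : Im (cexp h - 1 - h) = expR (Re h) * (sin (Im h) - Im h) + Im h * (expR (Re h) - 1).
  by rewrite !raddfB /=; ring.
set a := Re h in ha He H1 *; set b := Im h in hb Hc Hs *; set n := normc h in ha hb h5 h6 *.
have a2 : `|expR a - 1| <= 2 * `|a|.
  by rewrite -[expR a - 1](subrK a) (le_trans (ler_normD _ _))// mulr2n mulrDl mul1r lerD2r.
have E0 := expR_ge0 a.
have E2 : expR a <= 2.
  by move: a2; rewrite ler_norml => /andP[_]; lra.
have n0 : 0 <= n by apply: le_trans ha; exact: normr_ge0.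
have b0 := normr_ge0 b.
have t1 : `|expR a * (cos b - 1)| <= 2 * (e / 8 * n).
  rewrite normrM ger0_norm//; apply: ler_pM => //.
  by rewrite (le_trans Hc)// ler_pM2l.
have t2 : `|expR a * (sin b - b)| <= 2 * (e / 8 * n).
  rewrite normrM ger0_norm//; apply: ler_pM => //.
  by rewrite (le_trans Hs)// ler_pM2l.
have t3 : `|b * (expR a - 1)| <= n * (2 * (e / 8)).
  rewrite normrM; apply: ler_pM => //; rewrite (le_trans a2)// ler_pM2l//.
  by apply: le_trans ha _; exact: ltW.
have t4 : `|expR a - 1 - a| <= e / 8 * n by rewrite (le_trans He)// ler_pM2l.
apply: (@le_trans _ _ ((e / 8 * n + 2 * (e / 8 * n)) + (2 * (e / 8 * n) + n * (2 * (e / 8))))).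
  by apply: lerD; rewrite (le_trans (ler_normD _ _))// lerD.
have en : 0 <= e * n by rewrite mulr_ge0// ltW.
lra.
Qed.

Lemma entire_cexp k : entire (fun z => cexp (k * z)).
Proof.
move=> z; apply/derivableP_cderiv; exists (cexp (k * z) * k) => e e0.
have K0 : 0 < 1 + normc k by rewrite ltr_pwDl// normc_ge0.
have E0 : 0 < normc (cexp (k * z)) by rewrite normc_cexp expR_gt0.
have [r r0 H] := cexp_first_order (divr_gt0 e0 (mulr_gt0 K0 E0)).
exists (r / (1 + normc k)) => [|h]; first by rewrite divr_gt0.
rewrite ltr_pdivlMr// => hr.
have kh : normc (k * h) < r.
  by rewrite normcM (le_lt_trans _ hr)// mulrC ler_wpM2l ?normc_ge0// lerDr.
rewrite mulrDr cexpD.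
have -> : cexp (k * z) * cexp (k * h) - cexp (k * z) - cexp (k * z) * k * h =
  cexp (k * z) * (cexp (k * h) - 1 - k * h) by ring.
rewrite normcM; apply: (@le_trans _ _ (normc (cexp (k * z)) * (e / ((1 + normc k) * normc
  (cexp (k * z))) * normc (k * h)))).
  by rewrite ler_pM2l// H.
rewrite [X in X <= _](_ : _ = e * normc (k * h) / (1 + normc k)); last first.
  by field; rewrite !gt_eqF.
rewrite ler_pdivrMr// -mulrA ler_pM2l// normcM mulrC ler_wpM2l ?normc_ge0//.
by rewrite lerDr.
Qed.

End complex_exponential.

Section weighted_estimate.
Context {R : realType}.
Local Notation leb2 := (@lebesgue_measure R \x @lebesgue_measure R)%E.
Implicit Types (f : R[i] -> R[i]) (w z : R[i]) (alpha p : R).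
Local Notation Re := (@complex.Re R).
Local Notation Im := (@complex.Im R).
Local Notation cx v := (v.1 +i* v.2).
Local Notation mR := (measurableTypeR R).

Lemma fock_weighted_ge0 alpha f z : 0 <= fock_weighted alpha f z.
Proof. by rewrite mulr_ge0 ?normc_ge0 ?expR_ge0. Qed.

Lemma fock_weighted_measurable alpha f : entire f ->
  measurable_fun setT (fun v : mR * mR => fock_weighted alpha f (cx v)).
Proof.
move=> fE; apply: measurable_funM; first exact: cdiff_normc_measurable.
apply: measurableT_comp; first exact: measurable_expR.
apply: measurable_funM; first exact: measurable_cst.
by apply: measurable_funX; apply: (@cdiff_normc_measurable _ id) => z; exact: cdiff_id.
Qed.

Lemma fock_weighted_powR_measurable alpha f p : entire f ->
  measurable_fun setT (fun v : mR * mR => fock_weighted alpha f (cx v) `^ p).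
Proof.
by move=> fE; apply: measurableT_comp (measurable_powR p) _; exact: fock_weighted_measurable.
Qed.

Lemma muleEFin_rearrange (a b c : R) (I : \bar R) :
  ((a * b)%:E * I * c%:E = a%:E * ((b * c)%:E * I))%E.
Proof. by rewrite !EFinM -!muleA [(I * _)%E]muleC. Qed.

(* The function [f z * e^(- alpha (conj w) z)] is entire, and its modulus is the
   weighted modulus of [f] times [e^(alpha (|z - w|^2 - |w|^2) / 2)]. *)
Lemma weighted_area_estimate alpha p : 0 < alpha -> 0 < p -> exists2 C : R, 0 < C &
  forall f w, entire f ->
    ((fock_weighted alpha f w `^ p)%:E <=
     C%:E * \int[leb2]_(v in square (Re w) (Im w) 1) (fock_weighted alpha f (cx v) `^ p)%:E)%E.
Proof.
move=> a0 p0; have [C C0 H] := local_area_estimate p0.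
(* On the unit square [|v - w|^2 <= 2], so the extra factor [exp (alpha |v - w|^2 / 2)] is at most
   [exp alpha]. *)
exists (C * expR alpha `^ p); first by rewrite mulr_gt0// powR_gt0// expR_gt0.
move=> f w fE.
pose k : R[i] := (- (alpha * Re w)) +i* (alpha * Im w).
pose F z := f z * cexp (k * z).
have FE : entire F by move=> z; apply: cdiffM; [exact: fE|exact: entire_cexp].
pose W : R := expR (- (alpha / 2) * normc w ^+ 2).
have W0 : 0 < W by exact: expR_gt0.
have FG z : normc (F z) = fock_weighted alpha f z * expR (alpha / 2 * normc (z - w) ^+ 2) * W.
  rewrite /F normcM normc_cexp /fock_weighted -!mulrA; congr (_ * _).
  rewrite /W -!expRD; congr expR; rewrite !sqr_normc !raddfB Re_mulc /=; by field.
have Fw : normc (F w) = fock_weighted alpha f w * W.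
  by rewrite FG subrr normc0 expr0n/= mulr0 expR0 mulr1.
have {}H := H F w FE.
have Wp0 : 0 < (W `^ p) by rewrite powR_gt0.
rewrite Fw (powRM _ (fock_weighted_ge0 alpha f w) (ltW W0)) in H.
rewrite -(@lee_pmul2r _ (W `^ p)%:E)//= -EFinM; apply: (le_trans H).
have mS := @measurable_square R (Re w) (Im w) 1.
have mfw D : measurable_fun D (fun v : mR * mR => (fock_weighted alpha f (cx v) `^ p)%:E).
  by apply/measurable_EFinP/measurable_funTS; exact: fock_weighted_powR_measurable.
set I := (\int[leb2]_(v in square (Re w) (Im w) 1) (fock_weighted alpha f (cx v) `^ p)%:E)%E.
rewrite muleEFin_rearrange.
apply: lee_wpmul2l; first by rewrite lee_fin ltW.
rewrite /I -ge0_integralZl_EFin//; [|by move=> v _; rewrite lee_fin powR_ge0|by rewrite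
  mulr_ge0 ?powR_ge0].
apply: ge0_le_integral => //.
- by move=> v _; rewrite lee_fin powR_ge0.
- apply/measurable_EFinP/measurable_funTS; apply: measurableT_comp (measurable_powR p) _.
  exact: cdiff_normc_measurable.
- exact: measurable_funeM.
move=> v [/=]; rewrite !in_itv/= => /andP[a1 a2] /andP[b1 b2].
rewrite -EFinM lee_fin FG -!powRM ?expR_ge0 ?mulr_ge0 ?normc_ge0 ?fock_weighted_ge0 ?expR_ge0//.
apply: ge0_ler_powR; rewrite ?nnegrE ?mulr_ge0 ?normc_ge0 ?fock_weighted_ge0 ?expR_ge0 ?(ltW
  p0) ?(ltW W0)//.
rewrite [leRHS]mulrAC ler_pM2r// [leRHS]mulrC ler_wpM2l ?fock_weighted_ge0// ler_expR.
have s1 (t : R) : -1 <= t -> t <= 1 -> t ^+ 2 <= 1 by move=> t1 t2; nra.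
have X2 : normc (cx v - w) ^+ 2 <= 1 + 1.
  by rewrite sqr_normc !raddfB /= lerD// s1//; lra.
apply: (le_trans (ler_wpM2l _ X2)); last by lra.
by rewrite divr_ge0// ltW.
Qed.

End weighted_estimate.

(** * Gaussian kernels and the dilation estimate *)

Section gaussian_kernel.
Context {R : realType}.
Local Notation leb := (@lebesgue_measure R).
Local Notation leb2 := (@lebesgue_measure R \x @lebesgue_measure R)%E.
Implicit Types (f : R[i] -> R[i]) (w : R[i]) (alpha p c : R).
Local Notation Re := (@complex.Re R).
Local Notation Im := (@complex.Im R).
Local Notation cx v := (v.1 +i* v.2).
Local Notation mR := (measurableTypeR R).

Definition gauss c (t : R) : R := expR (- c * t ^+ 2).

Lemma gauss_ge0 c t : 0 <= gauss c t. Proof. exact: expR_ge0. Qed.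

Lemma measurable_gauss c : measurable_fun setT (gauss c).
Proof.
apply: measurableT_comp; first exact: measurable_expR.
by apply: measurable_funM; [exact: measurable_cst|exact: measurable_funX].
Qed.

(** Up to the constant [normal_peak s], this is the normal density with mean [a] and variance
    [1 / (2 c)]. What matters later is that [J] is the same for all translates. *)
Lemma integral_gauss c : 0 < c -> exists2 J : R, 0 < J &
  forall a, (\int[leb]_x (gauss c (x - a))%:E = J%:E)%E.
Proof.
move=> c0; pose s : R := Num.sqrt (2 * c)^-1.
have s2 : s ^+ 2 = (2 * c)^-1 by rewrite sqr_sqrtr// invr_ge0 mulr_ge0// ltW.
have s0 : s != 0 by rewrite gt_eqF// sqrtr_gt0 invr_gt0 mulr_gt0.
have P0 := normal_peak_gt0 s0.
exists (normal_peak s)^-1 => [|a]; first by rewrite invr_gt0.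
have := integral_normal_pdf a s; rewrite (normal_pdfE _ s0).
have -> : (fun x => (normal_peak s * normal_fun a s x)%:E) = (fun x => (normal_peak s)%:E *
  (gauss c (x - a))%:E)%E.
  apply/funext => x; rewrite -EFinM; congr (_ * _)%:E; rewrite /normal_fun /gauss s2; congr
    expR.
  by field; rewrite gt_eqF.
rewrite ge0_integralZl_EFin//; last 3 first.
- by move=> x _; rewrite lee_fin gauss_ge0.
- apply/measurable_EFinP; apply: measurableT_comp; first exact: measurable_gauss.
  exact: measurable_funB.
- exact: ltW.
move=> H; have := congr1 (fun t => (normal_peak s)^-1%:E * t)%E H.
by rewrite muleA -EFinM mulVf ?gt_eqF// mul1e mule1.
Qed.

(** The planar Gaussian [exp (- c |z - v|^2)], in the product form in which it is integrated one
    coordinate at a time. *)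
Definition kernel2 c (z v : mR * mR) : R := gauss c (z.1 - v.1) * gauss c (z.2 - v.2).

Lemma kernel2_ge0 c (z v : mR * mR) : 0 <= kernel2 c z v.
Proof. by rewrite mulr_ge0 ?gauss_ge0. Qed.

Lemma measurable_kernel2 c :
  measurable_fun setT (fun q : (mR * mR) * (mR * mR) => kernel2 c q.1 q.2).
Proof.
have m1 (F : mR * mR -> mR) : measurable_fun setT F ->
    measurable_fun setT (fun q : (mR * mR) * (mR * mR) => gauss c (F q.1 - F q.2)).
  move=> mF; apply: measurableT_comp; first exact: measurable_gauss.
  apply: measurable_funB; apply: measurableT_comp mF _; [exact: measurable_fst|exact:
    measurable_snd].
apply: measurable_funM; apply: m1; [exact: measurable_fst|exact: measurable_snd].
Qed.

Lemma measurable_kernel2l c (v : mR * mR) :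
  measurable_fun setT (fun z : mR * mR => (kernel2 c z v)%:E).
Proof.
have m1 (a : R) : measurable_fun setT (fun x : mR => gauss c (x - a)).
  by apply: measurableT_comp; [exact: measurable_gauss|exact: measurable_funB].
apply/measurable_EFinP; apply: measurable_funM.
  by apply: (measurableT_comp (m1 v.1)); exact: measurable_fst.
by apply: (measurableT_comp (m1 v.2)); exact: measurable_snd.
Qed.

Lemma integral_kernel2 c : 0 < c -> exists2 J : R, 0 < J &
  forall v, (\int[leb2]_z (kernel2 c z v)%:E = J%:E)%E.
Proof.
move=> /integral_gauss[J J0 HJ]; exists (J * J) => [|v]; first exact: mulr_gt0.
have mg a : measurable_fun setT (fun x : mR => (gauss c (x - a))%:E).
  by apply/measurable_EFinP; apply: measurableT_comp; [exact: measurable_gauss|exact: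
    measurable_funB].
have k0 (z : mR * mR) : (0 <= (kernel2 c z v)%:E)%E by rewrite lee_fin kernel2_ge0.
rewrite (@fubini_tonelli1 _ _ _ _ _ leb leb _ (measurable_kernel2l c v) k0).
rewrite /fubini_F /kernel2 /=.
under eq_integral => x _.
  under eq_integral do rewrite EFinM.
  rewrite ge0_integralZl_EFin//; [|by move=> y _; rewrite lee_fin gauss_ge0|exact: gauss_ge0].
  rewrite HJ muleC.
  over.
by rewrite ge0_integralZl_EFin// ?HJ// ?ltW// => x _; rewrite lee_fin gauss_ge0.
Qed.

(* An alias, because the sigma-finite structure that the library attaches to
   [\x] is only inferred for probability measures. *)
Definition area : set (mR * mR) -> \bar R := leb2.

HB.instance Definition _ := Measure.on area.

Lemma area_sigma_finite : sigma_finite setT area.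
Proof.
exists (fun n : nat => square 0 0 n%:R).
  apply/esym/seteqP; split => // -[x y] _.
  exists (Num.bound (`|x| + `|y|)) => //.
  have : `|x| + `|y| < (Num.bound (`|x| + `|y|))%:R by apply: archi_boundP; rewrite addr_ge0.
  have := normr_ge0 x; have := normr_ge0 y.
  set N := _%:R => y0 x0 xyN; have [xN yN] : `|x| <= N /\ `|y| <= N by split; lra.
  move: xN yN; rewrite !ler_norml => /andP[? ?] /andP[? ?].
  by split; rewrite /= in_itv/=; apply/andP; split; lra.
move=> n; split; first exact: measurable_square.
by rewrite /area leb2_square// ltry.
Qed.

HB.instance Definition _ := Measure_isSigmaFinite.Build _ _ _ area area_sigma_finite.

(** Exchange the integrals by Tonelli: for each fixed [v] the kernel has total mass [J] in [z]. The
    identity holds in [\bar R], finite or not. *)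
Lemma schur_kernel2 c : 0 < c -> exists2 J : R, 0 < J &
  forall g : mR * mR -> R, measurable_fun setT g -> (forall v, 0 <= g v) ->
  [/\ measurable_fun setT (fun z : mR * mR => \int[leb2]_v (g v * kernel2 c z v)%:E)%E &
  (\int[leb2]_z \int[leb2]_v (g v * kernel2 c z v)%:E = J%:E * \int[leb2]_v (g v)%:E)%E].
Proof.
move=> /integral_kernel2[J J0 HJ]; exists J => // g mg g0.
pose h (q : (mR * mR) * (mR * mR)) := (g q.2 * kernel2 c q.1 q.2)%:E.
have mh : measurable_fun setT h.
  apply/measurable_EFinP; apply: measurable_funM; last exact: measurable_kernel2.
  by apply: measurableT_comp mg _; exact: measurable_snd.
have h0 q : (0 <= h q)%E by rewrite lee_fin mulr_ge0// kernel2_ge0.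
pose m2 : {sigma_finite_measure set (mR * mR)%type -> \bar R} := area.
have H := @measurable_fun_fubini_tonelli_F _ _ _ _ _ m2 h mh h0.
rewrite /fubini_F /h /= in H.
split; first exact: H.
rewrite (@fubini_tonelli _ _ _ _ _ m2 m2 h mh h0) /h /=.
under eq_integral => v _.
  under eq_integral do rewrite EFinM.
  rewrite ge0_integralZl_EFin//; last 2 first.
  - by move=> z _; rewrite lee_fin kernel2_ge0.
  - exact: measurable_kernel2l.
  rewrite HJ muleC.
  over.
rewrite ge0_integralZl_EFin//; [by move=> v _; rewrite lee_fin
  g0|exact/measurable_EFinP|exact: ltW].
Qed.

End gaussian_kernel.

(** * Dilations dominated by a Gaussian convolution *)

Section dilation.
Context {R : realType}.
Local Notation leb2 := (@lebesgue_measure R \x @lebesgue_measure R)%E.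
Implicit Types (f : R[i] -> R[i]) (w : R[i]) (alpha p c s : R).
Local Notation Re := (@complex.Re R).
Local Notation Im := (@complex.Im R).
Local Notation cx v := (v.1 +i* v.2).
Local Notation mR := (measurableTypeR R).

Lemma measurable_kernel2r c (z : mR * mR) :
  measurable_fun setT (fun v : mR * mR => kernel2 c z v).
Proof.
have m1 (a : R) : measurable_fun setT (fun x : mR => gauss c (a - x)).
  by apply: measurableT_comp; [exact: measurable_gauss|exact: measurable_funB].
apply: measurable_funM.
  by apply: (measurableT_comp (m1 z.1)); exact: measurable_fst.
by apply: (measurableT_comp (m1 z.2)); exact: measurable_snd.
Qed.

(* Cauchy-Schwarz together with [(1 - s)^2 <= 1 - s^2] *)
Lemma square_dilation_le s (x u : R) : 0 <= s -> s <= 1 -> s * x - 1 <= u -> u <= s * x + 1 ->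
  (x - u) ^+ 2 <= 2 * (1 - s ^+ 2) * x ^+ 2 + 2.
Proof.
move=> s0 s1 u1 u2.
have h1 : (s * x - u) ^+ 2 <= 1 by nra.
have h2 : (x - u) ^+ 2 <= 2 * (x - s * x) ^+ 2 + 2 * (s * x - u) ^+ 2.
  by have := sqr_ge0 ((x - s * x) - (s * x - u)); nra.
have h3 : (x - s * x) ^+ 2 <= (1 - s ^+ 2) * x ^+ 2.
  have -> : (x - s * x) ^+ 2 = (1 - s) ^+ 2 * x ^+ 2 by ring.
  by apply: ler_wpM2r; [exact: sqr_ge0|nra].
lra.
Qed.

(** Neither [C] nor the kernel depends on [s]. The spare weight is [X]; summing [square_dilation_le]
    over both coordinates with the factor [p alpha / 4] bounds the exponent of the kernel by that of
    [X] plus [p alpha], whence the constant [expR (p * alpha)]. *)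
Lemma dilation_estimate alpha p : 0 < alpha -> 0 < p -> exists2 C : R, 0 < C &
  forall f (z : mR * mR) s, entire f -> 0 <= s <= 1 ->
  (((normc (f (s%:C * cx z)) * expR (- (alpha / 2) * normc (cx z) ^+ 2)) `^ p)%:E <=
  C%:E * \int[leb2]_v (fock_weighted alpha f (cx v) `^ p * kernel2 (p * alpha / 4) z v)%:E)%E.
Proof.
move=> a0 p0; have [C C0 H] := weighted_area_estimate a0 p0.
exists (C * expR (p * alpha)); first by rewrite mulr_gt0// expR_gt0.
move=> f z s fE /andP[s0 s1]; set w := s%:C * cx z.
pose X := expR (- (p * (alpha / 2) * (1 - s ^+ 2) * normc (cx z) ^+ 2)).
have X0 : 0 < X by exact: expR_gt0.
have -> : (normc (f w) * expR (- (alpha / 2) * normc (cx z) ^+ 2)) `^ p =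
    X * fock_weighted alpha f w `^ p.
  have -> : X = expR (- ((alpha / 2) * (1 - s ^+ 2) * normc (cx z) ^+ 2)) `^ p.
    by rewrite -expRM; congr expR; ring.
  rewrite -powRM ?expR_ge0 ?fock_weighted_ge0// //; congr (_ `^ _); rewrite /fock_weighted
    [RHS]mulrCA; congr (_ * _).
  rewrite -expRD; congr expR; rewrite /w normcM normcR (ger0_norm s0); ring.
have {}H := H f w fE.
have mS := @measurable_square R (Re w) (Im w) 1.
have mg D : measurable_fun D (fun v : mR * mR => (fock_weighted alpha f (cx v) `^ p)%:E).
  by apply/measurable_EFinP/measurable_funTS; exact: fock_weighted_powR_measurable.
have mk D : measurable_fun D (fun v : mR * mR => (fock_weighted alpha f (cx v) `^ p * kernel2
  (p * alpha / 4) z v)%:E).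
  apply/measurable_EFinP/measurable_funTS; apply: measurable_funM; first exact:
    fock_weighted_powR_measurable.
  exact: measurable_kernel2r.
have gk0 v : 0 <= fock_weighted alpha f (cx v) `^ p * kernel2 (p * alpha / 4) z v.
  by rewrite mulr_ge0 ?powR_ge0 ?kernel2_ge0.
apply: (@le_trans _ _ (X%:E * (C%:E * \int[leb2]_(v in square (Re w) (Im w) 1) (fock_weighted
  alpha f (cx v) `^ p)%:E))%E).
  by rewrite EFinM lee_wpmul2l// lee_fin ltW.
apply: (@le_trans _ _ ((C * expR (p * alpha))%:E * \int[leb2]_(v in square (Re w) (Im w) 1)
  (fock_weighted alpha f (cx v) `^ p * kernel2 (p * alpha / 4) z v)%:E)%E); last first.
  apply: lee_wpmul2l; first by rewrite lee_fin mulr_ge0 ?expR_ge0// ltW.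
  by apply: ge0_subset_integral => // v _; rewrite lee_fin.
rewrite muleA -EFinM [X * C]mulrC !EFinM -!muleA.
apply: lee_wpmul2l; first by rewrite lee_fin ltW.
rewrite -!ge0_integralZl_EFin ?expR_ge0 ?(ltW X0)//; try by move=> v _; rewrite lee_fin
  ?powR_ge0.
apply: ge0_le_integral => //.
- by move=> v _; rewrite -EFinM lee_fin mulr_ge0 ?powR_ge0// ltW.
- exact: measurable_funeM.
- exact: measurable_funeM.
move=> v [/=]; rewrite !in_itv/= => /andP[a1 a2] /andP[b1 b2].
rewrite -!EFinM lee_fin mulrCA [X * _]mulrC ler_wpM2l ?powR_ge0//.
rewrite /kernel2 /gauss -!expRD ler_expR.
rewrite !mul0r subr0 addr0 in a1 a2 b1 b2.
have c0 : 0 <= p * alpha / 4 by rewrite divr_ge0// mulr_ge0// ltW.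
have q1 := ler_wpM2l c0 (square_dilation_le s0 s1 a1 a2).
have q2 := ler_wpM2l c0 (square_dilation_le s0 s1 b1 b2).
rewrite sqr_normc /= -subr_ge0.
apply: le_trans (addr_ge0 (_ : 0 <= _) (_ : 0 <= _)) _.
  by rewrite -(subr_ge0 (_ * (z.1 - v.1) ^+ 2)) in q1; exact: q1.
  by rewrite -(subr_ge0 (_ * (z.2 - v.2) ^+ 2)) in q2; exact: q2.
by rewrite le_eqVlt; apply/orP; left; apply/eqP; field.
Qed.

End dilation.

(** * Hausdorff operators *)

Section entire_local.
Context {R : realType}.
Implicit Types (f : R[i] -> R[i]) (w z h : R[i]) (r : R).
Local Notation Re := (@complex.Re R).
Local Notation Im := (@complex.Im R).

Lemma entire_bounded f r : entire f -> exists2 M : R, 0 <= M &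
  forall z, normc z <= r -> normc (f z) <= M.
Proof.
move=> fE; have [r0|r0] := ltP r 0.
  by exists 0 => // z zr; have := le_lt_trans zr r0; rewrite ltNge normc_ge0.
pose K : set (R * R) := `[- r, r] `*` `[- r, r].
have [|||v0 Kv0 max0] := @compact_EVT_max _ _ (fun v : R * R => normc (f (v.1 +i* v.2))) K.
- by exists (0, 0); split; rewrite /= in_itv/= oppr_le0 r0.
- by apply: compact_setX; exact: segment_compact.
- by apply: continuous_subspaceT; exact: cdiff_normc_continuous.
exists (normc (f (v0.1 +i* v0.2))) => [|[x y] zr]; first exact: normc_ge0.
apply: (max0 (x, y)); rewrite inE; split; rewrite /= in_itv/= -ler_norml.
  exact: le_trans (Re_le_normc _) zr.
exact: le_trans (Im_le_normc _) zr.
Qed.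

Lemma cderiv_unique f z d1 d2 : cderiv f z d1 -> cderiv f z d2 -> d1 = d2.
Proof.
move=> h1 h2; apply/eqP; rewrite -subr_eq0; apply: contraT; rewrite -normc_gt0 => n0.
have e0 : 0 < normc (d1 - d2) / 4 by rewrite divr_gt0.
have [r1 r10 {}h1] := h1 _ e0; have [r2 r20 {}h2] := h2 _ e0.
pose t := Num.min r1 r2 / 2; have m0 : 0 < Num.min r1 r2 by rewrite lt_min r10.
have t0 : 0 < t by rewrite divr_gt0.
have nt : normc t%:C = t by rewrite normcR gtr0_norm.
have tm : t < Num.min r1 r2 by rewrite /t; lra.
move: tm; rewrite lt_min => /andP[t1 t2].
have := h1 t%:C; rewrite nt => /(_ t1) {}h1.
have := h2 t%:C; rewrite nt => /(_ t2) {}h2.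
have : normc ((d1 - d2) * t%:C) <= normc (d1 - d2) / 4 * t + normc (d1 - d2) / 4 * t.
  have -> : (d1 - d2) * t%:C = (f (z + t%:C) - f z - d2 * t%:C) - (f (z + t%:C) - f z - d1 *
    t%:C) by ring.
  by rewrite (le_trans (ler_normcD _ _))// normcN lerD.
rewrite normcM nt; nra.
Qed.

(** The remainder is uniform on discs, as needed to differentiate under the integral sign;
    continuity of [f'] gives measurability of the differentiated integrand. *)
Lemma entire_taylor f : entire f -> exists f' : R[i] -> R[i],
  [/\ forall z, cderiv f z (f' z), forall z, ccont f' z &
  forall r, exists2 K : R, 0 <= K &
    (forall w, normc w <= r -> normc (f' w) <= K) /\
    forall w h, normc w <= r -> normc h <= 1 / 2 ->
      normc (f (w + h) - f w - f' w * h) <= K * normc h ^+ 2].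
Proof.
move=> fE.
have [f' Hf'] := choice (fun z => (derivableP_cderiv f z).1 (fE z)).
have bound r : exists2 K : R, 0 <= K &
    (forall w, normc w <= r -> normc (f' w) <= K) /\
    forall w h, normc w <= r -> normc h <= 1 / 2 ->
      normc (f (w + h) - f w - f' w * h) <= K * normc h ^+ 2.
  (* Cauchy's estimates are applied on squares of half-side 1 centred in the disc of radius [r];
     these squares lie in the disc of radius [r + 2]. *)
  have [M M0 HM] := entire_bounded (r + 2) fE.
  have est w : normc w <= r -> normc (f' w) <= 32 * M / 1 /\
      forall z, normc (z - w) <= 1 / 2 ->
      normc (f z - f w - f' w * (z - w)) <= 32 * M * normc (z - w) ^+ 2 / 1 ^+ 2.
    move=> wr.
    have [u [[/andP[u1 u2] /andP[u3 u4]] _]|D [fD HD _ HT]] := @cauchy_estimates _ f w 1 M fE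
      ltr01.
      apply: HM; rewrite -(subrK w u) addrC.
      have : normc (u - w) <= 2.
        rewrite (le_trans (normc_le_ReIm _))// !raddfB /= -[2]/(1 + 1).
        by apply: lerD; rewrite ler_norml; apply/andP; split; lra.
      have := ler_normcD w (u - w); lra.
    by rewrite (cderiv_unique (Hf' w) fD).
  exists (32 * M); first by rewrite mulr_ge0.
  split => [w wr|w h wr hr]; first by have [+ _] := est w wr; rewrite divr1.
  have [_ /(_ (w + h))] := est w wr; rewrite [w + h]addrC addrK expr1n divr1; exact.
exists f'; split => // z e e0.
have [K K0 [_ HK]] := bound (normc z + 1).
have K1 : 0 < 2 * K + 1 by lra.
exists (Num.min (1 / 2) (e / (2 * K + 1))) => [|h]; first by rewrite lt_min !divr_gt0.
rewrite lt_min => /andP[h1 h2].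
have [->|h0] := eqVneq h 0; first by rewrite addr0 subrr normc0 ltW.
have nh : 0 < normc h by rewrite normc_gt0.
have {h2} : normc h * (2 * K + 1) < e by rewrite -ltr_pdivlMr.
have e1 := HK z h _ (ltW h1).
have e2 := HK (z + h) (- h); rewrite normcN in e2.
have {}e1 := e1 (_ : normc z <= normc z + 1); have {}e1 := e1 ltac:(lra).
have zh : normc (z + h) <= normc z + 1 by have := ler_normcD z h; lra.
have {}e2 := e2 zh (ltW h1); rewrite addrK in e2.
rewrite -(ler_pM2r nh) -normcM.
(* The expansion from [z] to [z + h] and the one back from [z + h] to [z] add up to this product, so
   [f'] is locally Lipschitz with constant [2 * K]. *)
have -> : (f' (z + h) - f' z) * h = (f (z + h) - f z - f' z * h) + (f z - f (z + h) - f' (z +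
  h) * - h) by ring.
have := ler_normcD (f (z + h) - f z - f' z * h) (f z - f (z + h) - f' (z + h) * - h).
nra.
Qed.

End entire_local.

Section hausdorff_operator.
Context {R : realType} (mu : {measure set R -> \bar R}).
Implicit Types (f : R[i] -> R[i]) (w z h : R[i]) (r : R).
Local Notation Re := (@complex.Re R).
Local Notation Im := (@complex.Im R).
Local Notation D := (`]0, +oo[%classic : set R).

Hypothesis mu1 : (\int[mu]_(t in D) (t^-1)%:E = 1)%E.

Lemma measurable_pos_axis : measurable D.
Proof. exact: measurable_itv. Qed.
Local Hint Resolve measurable_pos_axis : core.

Lemma pos_continuous_measurable (F : R -> R) :
  (forall t, 0 < t -> {for t, continuous F}) -> measurable_fun D F.
Proof.
move=> cF; apply: open_continuous_measurable_fun; first exact: interval_open.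
by move=> t; rewrite inE/= in_itv/= andbT => /cF.
Qed.

Lemma measurable_inv_pos : measurable_fun D (fun t : R => t^-1).
Proof. by apply: pos_continuous_measurable => t t0; apply: inv_continuous; rewrite gt_eqF. Qed.

Lemma measurable_ccont f z : (forall w, ccont f w) ->
  measurable_fun D (fun t : R => Re (f (z / t%:C))) /\ measurable_fun D (fun t : R => Im (f
    (z / t%:C))).
Proof.
move=> cf; have cz (u : R) : {for u, continuous (fun u : R => Re (f (z * u%:C)))} /\
    {for u, continuous (fun u : R => Im (f (z * u%:C)))}.
  have H e : 0 < e -> exists2 r : R, 0 < r & forall v : R, `|u - v| < r ->
      normc (f (z * u%:C) - f (z * v%:C)) <= e.
    move=> e0; have [r r0 H] := cf (z * u%:C) e e0.
    have z0 : 0 < normc z + 1 by rewrite ltr_wpDl// normc_ge0.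
    exists (r / (normc z + 1)) => [|v]; first by rewrite divr_gt0.
    rewrite ltr_pdivlMr// => uv; rewrite normcB.
    have -> : z * v%:C = z * u%:C + z * (v - u)%:C by rewrite -mulrDr -rmorphD/= subrKC.
    apply: H; rewrite normcM normcR distrC; apply: le_lt_trans uv.
    by rewrite mulrC ler_wpM2l// lerDl.
  split; apply/cvgrPdist_le => /= e /H[r r0 {}H]; apply/nbhs_ballP; exists r => //= v /H {}H.
    by apply: le_trans H; rewrite -raddfB; exact: Re_le_normc.
  by apply: le_trans H; rewrite -raddfB; exact: Im_le_normc.
have E t : z / t%:C = z * (t^-1)%:C by rewrite fmorphV.
split; apply: pos_continuous_measurable => t t0.
- have -> : (fun t => Re (f (z / t%:C))) = (fun u : R => Re (f (z * u%:C))) \o (fun t : R =>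
    t^-1).
    by apply/funext => s /=; rewrite E.
  by apply: continuous_comp; [apply: inv_continuous; rewrite gt_eqF|exact: (cz _).1].
- have -> : (fun t => Im (f (z / t%:C))) = (fun u : R => Im (f (z * u%:C))) \o (fun t : R =>
    t^-1).
    by apply/funext => s /=; rewrite E.
  by apply: continuous_comp; [apply: inv_continuous; rewrite gt_eqF|exact: (cz _).2].
Qed.

Lemma measurable_div_pos (g : R -> R[i]) :
  measurable_fun D (fun t : R => Re (g t)) -> measurable_fun D (fun t : R => Im (g t)) ->
  measurable_fun D (fun t : R => Re (g t / t%:C)) /\ measurable_fun D (fun t : R => Im (g t /
    t%:C)).
Proof.
move=> mr mi; have E t : (t%:C)^-1 = (t^-1)%:C :> R[i] by rewrite fmorphV.
split.
  have -> : (fun t => Re (g t / t%:C)) = (fun t => Re (g t)) \* (fun t : R => t^-1).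
    by apply/funext => t /=; rewrite E Re_mulc /= mulr0 subr0.
  exact: measurable_funM mr measurable_inv_pos.
have -> : (fun t => Im (g t / t%:C)) = (fun t => Im (g t)) \* (fun t : R => t^-1).
  by apply/funext => t /=; rewrite E Im_mulc /= mulr0 add0r.
exact: measurable_funM mi measurable_inv_pos.
Qed.

Section supported_at_one.
Hypothesis mu01 : mu `]0, 1[%classic = 0%E.

(** Domination for [t >= 1] is domination almost everywhere by [mu01], and [M / t] has integral [M]
    by the normalization [mu1]. *)
Lemma integrable_dominated (phi : R -> R) (M : R) : 0 <= M -> measurable_fun D phi ->
  (forall t, 1 <= t -> `|phi t| <= M / t) ->
  mu.-integrable D (EFin \o phi) /\ `| \int[mu]_(t in D) phi t | <= M.
Proof.
move=> M0 mphi H.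
have mI : measurable_fun D (fun t : R => (M / t)%:E).
  apply/measurable_EFinP; apply: measurable_funM; [exact: measurable_cst|exact:
    measurable_inv_pos].
have intM : (\int[mu]_(t in D) (M / t)%:E = M%:E)%E.
  under eq_integral do rewrite EFinM.
  rewrite ge0_integralZl_EFin ?mu1 ?mule1//.
    by move=> t; rewrite /= in_itv/= andbT => t0; rewrite lee_fin invr_ge0 ltW.
  by apply/measurable_EFinP; exact: measurable_inv_pos.
have dom : (\int[mu]_(t in D) `|(phi t)%:E| <= M%:E)%E.
  rewrite -intM; apply: ae_ge0_le_integral => //.
  - by apply: measurableT_comp => //; apply/measurable_EFinP.
  - by move=> t; rewrite /= in_itv/= andbT => t0; rewrite lee_fin; apply: divr_ge0 => //;
      exact: ltW.
  exists (`]0, 1[%classic : set R); split => //.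
  move=> t /=; apply: contra_notP; rewrite in_itv/= => /negP t01 Dt.
  move: Dt; rewrite in_itv/= andbT => t0; move: t01; rewrite t0 /= -leNgt => t1.
  by rewrite lee_fin H.
have iphi : mu.-integrable D (EFin \o phi).
  apply/integrableP; split; first exact/measurable_EFinP.
  by rewrite (le_lt_trans dom)// ltry.
split => //.
rewrite -lee_fin EFin_normr_Rintegral//; apply: le_trans dom; apply: le_abse_integral => //;
  exact/measurable_EFinP.
Qed.

Lemma cintegrable_dominated (g : R -> R[i]) (M : R) : 0 <= M ->
  measurable_fun D (fun t : R => Re (g t)) -> measurable_fun D (fun t : R => Im (g t)) ->
  (forall t, 1 <= t -> normc (g t) <= M / t) ->
  cintegrable mu D g /\ normc (cintegral mu D g) <= 2 * M.
Proof.
move=> M0 mr mi H.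
have [ir br] := integrable_dominated M0 mr (fun t t1 => le_trans (Re_le_normc _) (H t t1)).
have [ii bi] := integrable_dominated M0 mi (fun t t1 => le_trans (Im_le_normc _) (H t t1)).
split; first by split.
by rewrite (le_trans (normc_le_ReIm _))//= mulr2n mulrDl mul1r lerD.
Qed.

(** For [t >= 1] the point [z / t] is [s z] with [s = 1 / t] in the unit interval; the factor 2
    again comes from real and imaginary parts. *)
Lemma hausdorff_bound f z (M : R) : (forall w, ccont f w) -> 0 <= M ->
  (forall s : R, 0 <= s <= 1 -> normc (f (s%:C * z)) <= M) ->
  cintegrable mu D (hausdorff_integrand f z) /\ normc (hausdorff mu f z) <= 2 * M.
Proof.
move=> cf M0 H; have [mr mi] := measurable_ccont z cf.
have [mr' mi'] := measurable_div_pos mr mi.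
apply: cintegrable_dominated => // t t1.
have t0 : 0 < t by exact: lt_le_trans t1.
rewrite /hausdorff_integrand normcM normcV normcR gtr0_norm// ler_pM2r ?invr_gt0//.
rewrite mulrC -fmorphV; apply: H.
by rewrite invr_ge0 (ltW t0) invf_le1.
Qed.

Lemma normc_dilate_le (s : R) z : 0 <= s <= 1 -> normc (s%:C * z) <= normc z.
Proof. by move=> /andP[s0 s1]; rewrite normcM normcR ger0_norm// ler_piMl// normc_ge0. Qed.

Lemma hausdorff_integrable f z : entire f ->
  cintegrable mu D (hausdorff_integrand f z).
Proof.
move=> fE; have [M M0 HM] := entire_bounded (normc z) fE.
have cf w := cdiff_ccont (fE w).
by have [] := hausdorff_bound (z := z) cf M0 (fun s s01 => HM _ (normc_dilate_le z s01)).
Qed.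

(** Differentiation under the integral sign, with derivative the integral of [f' (z / t) / t^2]. For
    [t >= 1] both [z / t] and [h / t] shrink, so a single Taylor constant [K], taken at radius
    [|z|], bounds the remainder of the integrand by [K |h|^2 / t]. *)
Lemma hausdorff_entire f : entire f -> entire (hausdorff mu f).
Proof.
move=> fE z; apply/derivableP_cderiv.
have [f' [_ cf' HK]] := entire_taylor fE; have [K K0 [K1 K2]] := HK (normc z).
have [mr mi] := measurable_ccont z cf'.
have [mr1 mi1] := measurable_div_pos mr mi.
have [mr2 mi2] := measurable_div_pos mr1 mi1.
pose g (t : R) := f' (z / t%:C) / t%:C / t%:C.
have dil (t : R) w : 1 <= t -> normc (w / t%:C) <= normc w.
  move=> t1; rewrite mulrC -fmorphV; apply: normc_dilate_le.
  by rewrite invr_ge0 (le_trans ler01 t1) invf_le1// (lt_le_trans ltr01).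
have [ig _] : cintegrable mu D g /\ normc (cintegral mu D g) <= 2 * K.
  apply: cintegrable_dominated => // t t1; rewrite /g.
  have t0 : 0 < t by exact: lt_le_trans t1.
  rewrite normcM normcV normcR gtr0_norm// ler_pM2r ?invr_gt0//.
  by apply: le_trans (dil _ _ t1) _; apply/K1/dil.
exists (cintegral mu D g) => e e0.
exists (Num.min (1 / 2) (e / (2 * K + 1))) => [|h]; first by rewrite lt_min !divr_gt0//
  ltr_wpDl// mulr_ge0.
rewrite lt_min => /andP[h1 h2].
have [iz1 iz2] := (hausdorff_integrable (z + h) fE, hausdorff_integrable z fE).
have mD := measurable_pos_axis.
have igh := @cxintegrableZ _ _ _ mu D mD h g ig.
have idiff := @cxintegrableB _ _ _ mu D mD _ _ iz1 iz2.
have idiff2 := @cxintegrableB _ _ _ mu D mD _ _ idiff igh.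
have E : hausdorff mu f (z + h) - hausdorff mu f z - cintegral mu D g * h =
  cxintegral mu D (fun t => hausdorff_integrand f (z + h) t - hausdorff_integrand f z t - h *
    g t).
  rewrite (@cxintegralB _ _ _ mu D mD _ _ idiff igh) (@cxintegralB _ _ _ mu D mD _ _ iz1 iz2).
  by rewrite (@cxintegralZ _ _ _ mu D mD _ _ ig) [h * _]mulrC.
rewrite E.
have [_ B] : cintegrable mu D (fun t => hausdorff_integrand f (z + h) t - hausdorff_integrand
  f z t - h * g t) /\
   normc (cintegral mu D (fun t => hausdorff_integrand f (z + h) t - hausdorff_integrand f z
     t - h * g t)) <=
   2 * (K * normc h ^+ 2).
  case: (idiff2) => ir ii; apply: cintegrable_dominated.
  - by rewrite mulr_ge0// sqr_ge0.
  - by apply/measurable_EFinP; case/integrableP: ir.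
  - by apply/measurable_EFinP; case/integrableP: ii.
  move=> t t1; have t0 : 0 < t by exact: lt_le_trans t1.
  have -> : hausdorff_integrand f (z + h) t - hausdorff_integrand f z t - h * g t =
      (f (z / t%:C + h / t%:C) - f (z / t%:C) - f' (z / t%:C) * (h / t%:C)) / t%:C.
    by rewrite /hausdorff_integrand /g -mulrDl; ring.
  rewrite normcM normcV normcR gtr0_norm// ler_pM2r ?invr_gt0//.
  apply: le_trans (K2 _ _ (dil _ _ t1) (le_trans (dil _ _ t1) (ltW h1))) _.
  by rewrite ler_wpM2l// lerXn2r ?nnegrE ?normc_ge0// dil.
apply: le_trans B _; rewrite expr2 !mulrA ler_wpM2r ?normc_ge0//.
have K1' : 0 < 2 * K + 1 by lra.
move: h2; rewrite ltr_pdivlMr//; have := normc_ge0 h; nra.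
Qed.

End supported_at_one.
End hausdorff_operator.

(** * Fock norms *)

Section fock_norms.
Context {R : realType}.
Local Notation leb2 := (@lebesgue_measure R \x @lebesgue_measure R)%E.
Implicit Types (f : R[i] -> R[i]) (alpha : R).
Local Notation Re := (@complex.Re R).
Local Notation Im := (@complex.Im R).
Local Notation cx v := (v.1 +i* v.2).
Local Notation mR := (measurableTypeR R).

Definition fock_integral alpha (r : R) f : \bar R :=
  (\int[leb2]_w ((fock_weighted alpha f (cx w)) `^ r)%:E)%E.

Lemma fock_integral_ge0 alpha r f : (0 <= fock_integral alpha r f)%E.
Proof. by apply: integral_ge0 => w _; rewrite lee_fin powR_ge0. Qed.

Lemma poweR_le_scale (s K : R) (Y Z : \bar R) : 0 <= s -> 0 <= K ->
  (0 <= Y)%E -> (0 <= Z)%E -> (Y <= K%:E * Z)%E ->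
  (Y `^ s <= (K `^ s)%:E * Z `^ s)%E.
Proof.
move=> s0 K0 Y0 Z0 YZ; rewrite -poweR_EFin -poweRM ?lee_fin//.
by apply: gt0_ler_poweR; rewrite // in_itv/= ?leey ?andbT// mule_ge0// lee_fin.
Qed.

Lemma fock_normE alpha (r : R) f :
  fock_norm alpha r%:E f = (((alpha * r / (2 * pi))%:E * fock_integral alpha r f) `^ r^-1)%E.
Proof. by []. Qed.

Lemma fock_const_gt0 alpha r : 0 < alpha -> 0 < r -> 0 < alpha * r / (2 * pi).
Proof. by move=> a0 r0; rewrite divr_gt0 ?mulr_gt0// pi_gt0. Qed.

Lemma fock_norm_le alpha r f g (K : R) : 0 < alpha -> 0 < r -> 0 <= K ->
  (fock_integral alpha r g <= K%:E * fock_integral alpha r f)%E ->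
  (fock_norm alpha r%:E g <= (K `^ r^-1)%:E * fock_norm alpha r%:E f)%E.
Proof.
move=> a0 r0 K0 H; have c0 := fock_const_gt0 a0 r0; rewrite !fock_normE.
apply: poweR_le_scale.
- by rewrite invr_ge0 ltW.
- exact: K0.
- by rewrite mule_ge0 ?fock_integral_ge0// lee_fin ltW.
- by rewrite mule_ge0 ?fock_integral_ge0// lee_fin ltW.
by rewrite muleCA lee_wpmul2l// lee_fin ltW.
Qed.

Lemma fock_pointwise alpha (q : \bar R) : 0 < alpha -> (0 < q)%E -> exists2 C : R, 0 < C &
  forall f z, entire f -> ((fock_weighted alpha f z)%:E <= C%:E * fock_norm alpha q f)%E.
Proof.
move=> a0; case: q => [r| |]//; last first.
  move=> _; exists 1 => // f z fE; rewrite mul1e.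
  by apply: ereal_sup_ubound; exists z.
rewrite lte_fin => r0; have [C C0 H] := weighted_area_estimate a0 r0.
have c0 := fock_const_gt0 a0 r0; set c := alpha * r / (2 * pi) in c0.
exists ((C / c) `^ r^-1) => [|f z fE]; first by rewrite powR_gt0// divr_gt0.
have x0 := fock_weighted_ge0 alpha f z.
have -> : (fock_weighted alpha f z)%:E = (((fock_weighted alpha f z) `^ r)%:E `^ r^-1)%E.
  by rewrite poweR_EFin -powRrM mulfV ?gt_eqF// powRr1.
rewrite fock_normE; apply: poweR_le_scale.
- by rewrite invr_ge0 ltW.
- by rewrite divr_ge0// ltW.
- by rewrite lee_fin powR_ge0.
- by rewrite mule_ge0 ?fock_integral_ge0// lee_fin ltW.
apply: (le_trans (H f z fE)); rewrite muleA -EFinM divfK ?gt_eqF//.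
apply: lee_wpmul2l; first by rewrite lee_fin ltW.
apply: ge0_subset_integral => //.
- exact: measurable_square.
- by apply/measurable_EFinP; exact: fock_weighted_powR_measurable.
- by move=> v _; rewrite lee_fin powR_ge0.
Qed.

End fock_norms.

(** * Sufficiency: measures that do not charge (0, 1) *)

Section supported_implies_bounded.
Context {R : realType} (mu : {measure set R -> \bar R}) (alpha : R).
Local Notation leb2 := (@lebesgue_measure R \x @lebesgue_measure R)%E.
Implicit Types (f : R[i] -> R[i]).
Local Notation cx v := (v.1 +i* v.2).
Local Notation mR := (measurableTypeR R).
Local Notation D := (`]0, +oo[%classic : set R).

Hypothesis alpha0 : 0 < alpha.
Hypothesis mu1 : (\int[mu]_(t in D) (t^-1)%:E = 1)%E.
Hypothesis mu01 : mu `]0, 1[%classic = 0%E.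

Lemma fock_weighted_hausdorff_le f z (M : R) : entire f -> 0 <= M ->
  (forall s : R, 0 <= s <= 1 -> normc (f (s%:C * z)) * expR (- (alpha / 2) * normc z ^+ 2) <=
    M) ->
  fock_weighted alpha (hausdorff mu f) z <= 2 * M.
Proof.
move=> fE M0 H; set W := expR _ in H.
have W0 : 0 < W by exact: expR_gt0.
have cf w := cdiff_ccont (fE w).
have [] := @hausdorff_bound R mu mu1 mu01 f z (M / W) cf.
- by rewrite divr_ge0// ltW.
- by move=> s /H; rewrite ler_pdivlMr.
by move=> _; rewrite /fock_weighted -/W mulrA ler_pdivlMr.
Qed.

Lemma hausdorff_integral_le (r : R) : 0 < r -> exists2 K : R, 0 < K &
  forall f, entire f -> (fock_integral alpha r (hausdorff mu f) <= K%:E * fock_integral alpha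
    r f)%E.
Proof.
move=> r0; have [C C0 H] := dilation_estimate alpha0 r0.
have c0 : 0 < r * alpha / 4 by rewrite divr_gt0// mulr_gt0.
have [J J0 HJ] := schur_kernel2 c0.
exists (2 `^ r * C * J); first by rewrite !mulr_gt0// powR_gt0.
move=> f fE.
pose g (v : mR * mR) := fock_weighted alpha f (cx v) `^ r.
have mg : measurable_fun setT g by exact: fock_weighted_powR_measurable.
have g0 v : 0 <= g v by exact: powR_ge0.
have [mT HT] := HJ g mg g0.
pose T (z : mR * mR) : \bar R := (\int[leb2]_v (g v * kernel2 (r * alpha / 4) z v)%:E)%E.
have T0 z : (0 <= T z)%E by apply: integral_ge0 => v _; rewrite lee_fin mulr_ge0// kernel2_ge0.
have K0 : 0 < 2 `^ r * C by rewrite mulr_gt0// powR_gt0.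
have Hz (z : mR * mR) : ((fock_weighted alpha (hausdorff mu f) (cx z) `^ r)%:E <= (2 `^ r *
  C)%:E * T z)%E.
  have {}H s := H f z s fE; rewrite -/(T z) in H.
  (* Where the convolution is infinite the bound is trivial. Elsewhere the estimate for the powers
     is turned by an [r]-th root into a bound valid for all [s], to which the linear estimate of the
     operator applies. *)
  case: (T z) (T0 z) H => [t| |]// t0 {}H; last by rewrite gt0_muley ?lte_fin// leey.
  rewrite lee_fin in t0.
  have Ct : 0 <= C * t by rewrite mulr_ge0// ltW.
  rewrite -EFinM lee_fin -mulrA.
  have -> : C * t = ((C * t) `^ r^-1) `^ r by rewrite -powRrM mulVf ?gt_eqF// powRr1.
  rewrite -powRM ?powR_ge0//; apply: ge0_ler_powR; rewrite ?nnegrE ?fock_weighted_ge0 ?(ltW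
    r0)//.
    by rewrite mulr_ge0 ?powR_ge0.
  apply: fock_weighted_hausdorff_le => //; first exact: powR_ge0.
  move=> s /H; rewrite -EFinM lee_fin => {}H.
  set X := _ * expR _ in H *.
  have X0 : 0 <= X by rewrite mulr_ge0 ?normc_ge0 ?expR_ge0.
  have -> : X = (X `^ r) `^ r^-1 by rewrite -powRrM mulfV ?gt_eqF// powRr1.
  by apply: ge0_ler_powR; rewrite ?nnegrE ?powR_ge0// invr_ge0 ltW.
have HE := hausdorff_entire mu1 mu01 fE.
rewrite [(2 `^ r * C * J)%:E]EFinM -muleA -HT -ge0_integralZl_EFin//;
  [|by move=> z _; exact: T0|exact: ltW].
apply: ge0_le_integral => //.
- by move=> v _; rewrite lee_fin powR_ge0.
- by apply/measurable_EFinP; exact: (fock_weighted_powR_measurable alpha r HE).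
- exact: measurable_funeM.
Qed.

Lemma hausdorff_bounded_diag (p : \bar R) : (0 < p)%E -> hausdorff_bounded mu alpha p p.
Proof.
case: p => [r| |]; last by rewrite ltNge leNye.
  rewrite lte_fin => r0; have [K K0 HK] := hausdorff_integral_le r0.
  have est f : entire f -> (fock_norm alpha r%:E (hausdorff mu f) <= (K `^ r^-1)%:E *
    fock_norm alpha r%:E f)%E.
    by move=> fE; apply: fock_norm_le => //; [exact: ltW|exact: HK].
  split; last first.
    by exists (K `^ r^-1); split; [exact: powR_gt0|move=> f [fE _]; exact: est].
  move=> f [fE fn]; split; first by move=> z; exact: (hausdorff_integrable mu1 mu01).
  split; first exact: (hausdorff_entire mu1 mu01).
  by rewrite (le_lt_trans (est f fE))// lte_mul_pinfty// ?lee_fin ?powR_ge0.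
move=> _.
(* For the sup norm no kernel intervenes: the weight decreases with the modulus, so the weight at
   [z] is at most the weight at [s z]. *)
have est f : entire f -> (fock_norm alpha +oo f < +oo)%E ->
    (fock_norm alpha +oo (hausdorff mu f) <= 2%:E * fock_norm alpha +oo f)%E.
  move=> fE fn.
  have fle z : ((fock_weighted alpha f z)%:E <= fock_norm alpha +oo f)%E.
    by apply: ereal_sup_ubound; exists z.
  have n0 : (0 <= fock_norm alpha +oo f)%E.
    by apply: le_trans (fle 0); rewrite lee_fin fock_weighted_ge0.
  case: (fock_norm alpha +oo f) n0 fn fle => [M| |]// M0 _ fle.
  rewrite lee_fin in M0; apply: ge_ereal_sup => _ [z _ <-].
  rewrite -EFinM lee_fin; apply: fock_weighted_hausdorff_le => // s s01.
  have := fle (s%:C * z); rewrite lee_fin; apply: le_trans.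
  apply: ler_wpM2l; first exact: normc_ge0.
  rewrite ler_expR !mulNr lerN2 ler_wpM2l ?divr_ge0 ?(ltW alpha0)//.
  by rewrite lerXn2r ?nnegrE ?normc_ge0// normc_dilate_le.
split; last by exists 2; split => // f [fE fn]; exact: est.
move=> f [fE fn]; split; first by move=> z; exact: (hausdorff_integrable mu1 mu01).
split; first exact: (hausdorff_entire mu1 mu01).
by rewrite (le_lt_trans (est f fE fn))// lte_mul_pinfty.
Qed.

End supported_implies_bounded.

Section embedding.
Context {R : realType} (mu : {measure set R -> \bar R}) (alpha : R).
Hypothesis alpha0 : 0 < alpha.

Lemma fock_norm_embedding (p : \bar R) : (0 < p)%E -> exists2 C : R, 0 < C &
  forall f, entire f -> (fock_norm alpha +oo f <= C%:E * fock_norm alpha p f)%E.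
Proof.
move=> p0; have [C C0 HC] := fock_pointwise alpha0 p0; exists C => // f fE.
by apply: ge_ereal_sup => _ [z _ <-]; exact: HC.
Qed.

Lemma hausdorff_bounded_embedding (p : \bar R) : (0 < p)%E ->
  hausdorff_bounded mu alpha p p -> hausdorff_bounded mu alpha p +oo%E.
Proof.
move=> p0 [H1 [C [C0 HC]]].
have [C' C'0 HC'] := fock_norm_embedding p0.
have est f : fock_space alpha p f ->
    (fock_norm alpha +oo (hausdorff mu f) <= (C' * C)%:E * fock_norm alpha p f)%E.
  move=> fF; have [_ [HE _]] := H1 f fF.
  apply: (le_trans (HC' _ HE)); rewrite EFinM -muleA.
  by apply: lee_wpmul2l; [rewrite lee_fin ltW|exact: HC].
split; last by exists (C' * C); split; [exact: mulr_gt0|exact: est].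
move=> f fF; have [h1 [h2 h3]] := H1 f fF; split; first exact: h1.
split; first exact: h2.
apply: le_lt_trans (HC' _ h2) _; apply: lte_mul_pinfty h3 => //.
by rewrite lee_fin ltW.
Qed.

End embedding.

(** * Monomials *)

Section monomials.
Context {R : realType} (alpha : R).
Hypothesis alpha0 : 0 < alpha.
Local Notation leb2 := (@lebesgue_measure R \x @lebesgue_measure R)%E.
Implicit Types (z : R[i]).
Local Notation Re := (@complex.Re R).
Local Notation Im := (@complex.Im R).
Local Notation cx v := (v.1 +i* v.2).
Local Notation mR := (measurableTypeR R).

Definition monomial (n : nat) z : R[i] := z ^+ n.

Lemma entire_monomial n : entire (monomial n).
Proof.
elim: n => [|n IH] z; first by rewrite /monomial; exact: cdiff_cst.
have -> : monomial n.+1 = (fun z => z * monomial n z) by apply/funext => w; rewrite /monomial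
  exprS.
by apply: cdiffM; [exact: cdiff_id|exact: IH].
Qed.

Lemma normc_monomial n z : normc (monomial n z) = normc z ^+ n.
Proof.
elim: n => [|n IH]; first by rewrite /monomial !expr0 normc1.
by rewrite /monomial !exprS normcM; congr (_ * _).
Qed.

(* The point where [r ^ n * exp (- alpha r^2 / 2)] is maximal. *)
Definition peak_radius (n : nat) : R := Num.sqrt (n%:R / alpha).

Definition peak (n : nat) : R := peak_radius n ^+ n * expR (- (alpha / 2) * peak_radius n ^+ 2).

Lemma peak_radius_ge0 n : 0 <= peak_radius n. Proof. exact: sqrtr_ge0. Qed.

Lemma sqr_peak_radius n : peak_radius n ^+ 2 = n%:R / alpha.
Proof. by rewrite sqr_sqrtr// divr_ge0// ltW. Qed.

Lemma peak_gt0 n : 0 < peak n.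
Proof.
rewrite mulr_gt0 ?expR_gt0//; case: n => [|n]; first by rewrite expr0.
by rewrite exprn_gt0// sqrtr_gt0 divr_gt0.
Qed.

(** After rescaling by the peak radius, this is the [n]-th power of [v <= exp ((v^2 - 1) / 2)],
    which follows from [1 + x <= exp x] and [(v - 1)^2 >= 0]. The radius is 0 for [n = 0], hence the
    separate case. *)
Lemma le_peak n (u : R) : 0 <= u -> u ^+ n * expR (- (alpha / 2) * u ^+ 2) <= peak n.
Proof.
move=> u0; rewrite /peak sqr_peak_radius; case: n => [|n].
  rewrite !expr0 !mul1r mul0r mulr0 ler_expR mulNr oppr_le0 mulr_ge0 ?sqr_ge0//.
  by rewrite divr_ge0// ltW.
set rho := peak_radius n.+1; have rho0 : 0 < rho by rewrite sqrtr_gt0 divr_gt0.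
have rho2 : rho ^+ 2 = n.+1%:R / alpha by exact: sqr_peak_radius.
pose v := u / rho; have v0 : 0 <= v by rewrite divr_ge0// ltW.
have uE : u = v * rho by rewrite divfK// gt_eqF.
have ve : v <= expR ((v ^+ 2 - 1) / 2).
  apply: le_trans (expR_ge1Dx _).
  by have := sqr_ge0 (v - 1); rewrite sqrrB; nra.
have -> : - (alpha / 2) * u ^+ 2 = - (alpha / 2) * (n.+1%:R / alpha) + n.+1%:R * - ((v ^+ 2 -
  1) / 2).
  by rewrite uE exprMn rho2; field; rewrite gt_eqF.
rewrite expRD mulrCA mulrC ler_wpM2r ?expR_ge0//.
rewrite uE exprMn expRM_natl expRN exprVn -mulrA mulrCA ler_piMr ?exprn_ge0 ?(ltW rho0)//.
by rewrite ler_pdivrMr ?exprn_gt0 ?expR_gt0// mul1r lerXn2r// nnegrE ?expR_ge0.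
Qed.

(** Applying [le_peak] at [kappa |z|] spends only a part of the weight. For [kappa < 1] the rest is
    an integrable Gaussian that does not depend on [n]; the price is [kappa^-n]. *)
Lemma fock_weighted_monomial_le n (kappa : R) z : 0 < kappa ->
  fock_weighted alpha (monomial n) z <=
  peak n / kappa ^+ n * expR (- (alpha / 2 * (1 - kappa ^+ 2)) * normc z ^+ 2).
Proof.
move=> k0; have := le_peak n (mulr_ge0 (ltW k0) (normc_ge0 z)).
rewrite exprMn => H; rewrite /fock_weighted normc_monomial.
have -> : expR (- (alpha / 2) * normc z ^+ 2) = expR (- (alpha / 2) * (kappa * normc z) ^+ 2) *
    expR (- (alpha / 2 * (1 - kappa ^+ 2)) * normc z ^+ 2).
  by rewrite -expRD; congr expR; ring.
rewrite [X in X <= _]mulrA; apply: ler_wpM2r; first exact: expR_ge0.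
by rewrite ler_pdivlMr ?exprn_gt0// mulrC mulrA.
Qed.

Lemma fock_norm_monomial_le (p kappa : R) : 0 < p -> 0 < kappa < 1 -> exists2 K : R, 0 < K &
  forall n, (fock_norm alpha p%:E (monomial n) <= (K * (peak n / kappa ^+ n))%:E)%E.
Proof.
move=> p0 /andP[k0 k1].
have c0 : 0 < p * (alpha / 2 * (1 - kappa ^+ 2)).
  rewrite !mulr_gt0 ?divr_gt0// subr_gt0 -[ltRHS](expr1n _ 2).
  by rewrite ltrXn2r// ?nnegrE// ltW.
set c := p * _ in c0; have [J J0 HJ] := integral_kernel2 c0.
have f0 := fock_const_gt0 alpha0 p0.
exists ((alpha * p / (2 * pi) * J) `^ p^-1) => [|n].
  by rewrite powR_gt0// mulr_gt0.
set A := peak n / kappa ^+ n; have A0 : 0 < A by rewrite divr_gt0 ?peak_gt0// exprn_gt0.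
have AE : A%:E = ((A `^ p)%:E `^ p^-1)%E.
  by rewrite poweR_EFin -powRrM mulfV ?gt_eqF// powRr1 ?(ltW A0).
rewrite EFinM AE fock_normE; apply: poweR_le_scale.
- by rewrite invr_ge0 ltW.
- by rewrite mulr_ge0 ?(ltW f0) ?(ltW J0).
- by rewrite mule_ge0 ?fock_integral_ge0// lee_fin ltW.
- by rewrite lee_fin powR_ge0.
rewrite [X in (_ <= X * _)%E]EFinM -muleA; apply: lee_wpmul2l; first by rewrite lee_fin ltW.
have K0 : 0 <= A `^ p by exact: powR_ge0.
rewrite -(HJ (0, 0)) muleC -ge0_integralZl_EFin//; last 2 first.
- by move=> v _; rewrite lee_fin kernel2_ge0.
- exact: measurable_kernel2l.
have mM : measurable_fun setT (fun v : mR * mR => fock_weighted alpha (monomial n) (cx v) `^ p).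
  exact: fock_weighted_powR_measurable (@entire_monomial n).
rewrite /fock_integral; apply: ge0_le_integral => //.
- by move=> v _; rewrite lee_fin powR_ge0.
- by apply/measurable_EFinP.
- by apply: measurable_funeM; exact: measurable_kernel2l.
move=> v _; rewrite -EFinM lee_fin.
have -> : kernel2 c v (0, 0) = expR (- (alpha / 2 * (1 - kappa ^+ 2)) * normc (cx v) ^+ 2) `^ p.
  rewrite /kernel2 /gauss !subr0 -expRD -expRM sqr_normc /=; congr expR; rewrite /c; ring.
rewrite -(powRM _ (ltW A0) (expR_ge0 _)).
apply: ge0_ler_powR; rewrite ?nnegrE ?(ltW p0) ?fock_weighted_ge0//.
- by rewrite mulr_ge0 ?expR_ge0// ltW.
- exact: fock_weighted_monomial_le.
Qed.

End monomials.

(** * Necessity: boundedness forces [mu] to vanish on (0, 1) *)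

Section bounded_implies_supported.
Context {R : realType} (mu : {measure set R -> \bar R}) (alpha : R).
Local Notation Re := (@complex.Re R).
Local Notation Im := (@complex.Im R).
Local Notation D := (`]0, +oo[%classic : set R).
Hypothesis alpha0 : 0 < alpha.

(** At a nonnegative real point the integrand is [r^n t^(-n-1) >= 0], so its integral may be
    restricted to [(0, a]], where [1 / t >= 1 / a]. *)
Lemma hausdorff_monomial_ge n (a r : R) : 0 < a -> 0 <= r ->
  cintegrable mu D (hausdorff_integrand (monomial n) r%:C) ->
  ((r ^+ n * (a^-1 ^+ n * a^-1))%:E * mu [set` `]0, a]%R] <=
   (normc (hausdorff mu (monomial n) r%:C))%:E)%E.
Proof.
move=> a0 r0 [ir _]; pose phi (t : R) : R := r ^+ n * (t^-1 ^+ n * t^-1).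
have E t : Re (hausdorff_integrand (monomial n) r%:C t) = phi t.
  rewrite /hausdorff_integrand /monomial -!fmorphV -rmorphM -rmorphXn -rmorphM /=.
  by rewrite /phi exprMn mulrA.
have mD : measurable D by exact: measurable_itv.
have ma : measurable (`]0, a]%classic : set R) by exact: measurable_itv.
have phi0 t : 0 < t -> 0 <= phi t.
  by move=> t0; rewrite mulr_ge0 ?exprn_ge0// mulr_ge0 ?exprn_ge0 ?invr_ge0// ltW.
have iphi : mu.-integrable D (EFin \o phi).
  by apply: eq_integrable ir => // t _; rewrite E.
have sub : (`]0, a]%classic : set R) `<=` D.
  by move=> t; rewrite /= !in_itv/= => /andP[-> _].
have mphi : measurable_fun D (EFin \o phi) by case/integrableP: iphi.
apply: (@le_trans _ _ (\int[mu]_(t in D) (phi t)%:E)%E); last first.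
  have -> : (\int[mu]_(t in D) (phi t)%:E)%E = (\int[mu]_(t in D) phi t)%:E.
    by rewrite /Rintegral fineK//; exact: integrable_fin_num.
  rewrite lee_fin; apply: le_trans (Re_le_normc _); apply: le_trans (ler_norm _).
  by rewrite le_eqVlt; apply/orP; left; apply/eqP/eq_Rintegral => t _; rewrite E.
apply: (@le_trans _ _ (\int[mu]_(t in [set` `]0, a]%R]) (phi t)%:E)%E); last first.
  by apply: ge0_subset_integral => // t; rewrite /= in_itv/= andbT => t0; rewrite lee_fin phi0.
rewrite -integral_cst//; apply: ge0_le_integral => //.
- by move=> t _; rewrite lee_fin mulr_ge0 ?exprn_ge0// mulr_ge0 ?exprn_ge0 ?invr_ge0// ltW.
- by apply: measurable_funS mphi.
move=> t; rewrite /= in_itv/= => /andP[t0 ta].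
have ia : a^-1 <= t^-1 by rewrite lef_pV2 ?posrE.
rewrite lee_fin /phi ler_wpM2l ?exprn_ge0//; apply: ler_pM; rewrite ?exprn_ge0 ?invr_ge0
  ?(ltW a0)//.
by rewrite lerXn2r ?nnegrE ?invr_ge0 ?(ltW a0) ?(ltW t0).
Qed.

Lemma le0_of_geometric (x K q : R) : 0 <= q < 1 -> (forall n, x <= K * q ^+ n) -> x <= 0.
Proof.
move=> /andP[q0 q1] H.
have cv : (fun n => K * q ^+ n) @ \oo --> K * 0.
  by apply: cvgM; [exact: cvg_cst|apply: cvg_expr; rewrite ger0_norm].
rewrite mulr0 in cv; rewrite -(cvg_lim _ cv)//.
by apply: limr_ge; [apply/cvg_ex; exists 0|exact: nearW].
Qed.

(** Evaluate at the peak radius: the weighted lower bound contains [peak n * a^(-n-1) * mu (0, a]],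
    the upper one [peak n / kappa^n]. The peaks cancel, leaving [mu (0, a] = O ((a / kappa)^n)]. *)
Lemma bounded_null_itv (p q : \bar R) (a : R) : (0 < p)%E -> (p < q)%E ->
  hausdorff_bounded mu alpha p q -> 0 < a < 1 -> mu (`]0, a]%classic : set R) = 0%E.
Proof.
move=> p0 pq [H1 [C [C0 H2]]] /andP[a0 a1].
have q0 : (0 < q)%E by exact: lt_trans pq.
(* The strict inequality [p < q] excludes [p = +oo], so monomial norms are genuine integrals. *)
case: p p0 pq H1 H2 => [p| |]//; last by move=> _; rewrite ltNge leey.
rewrite lte_fin => p0 _ H1 H2.
(* Below 1 for the monomial norms, above [a] for geometric decay of [(a / kappa)^n]. *)
pose kappa := (1 + a) / 2; have k01 : 0 < kappa < 1 by rewrite /kappa; apply/andP; split; lra.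
have [K K0 HK] := fock_norm_monomial_le alpha0 p0 k01.
have [Cq Cq0 HCq] := fock_pointwise alpha0 q0.
have ak : 0 <= a / kappa < 1.
  case/andP: k01 => k0 k1; rewrite divr_ge0 ?(ltW a0) ?(ltW k0)//= ltr_pdivrMr// mul1r
    /kappa; lra.
have main n : (mu [set` `]0, a]%R] <= (Cq * C * K * a * (a / kappa) ^+ n)%:E)%E.
  have mF : fock_space alpha p%:E (monomial n).
    by split; [exact: entire_monomial|rewrite (le_lt_trans (HK n))// ltry].
  have [ci [HE _]] := H1 _ mF.
  set rho := peak_radius alpha n.
  have lower := hausdorff_monomial_ge a0 (peak_radius_ge0 alpha n) (ci rho%:C).
  have upper : ((fock_weighted alpha (hausdorff mu (monomial n)) rho%:C) <= Cq * (C * (K *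
    (peak alpha n / kappa ^+ n)))).
    rewrite -lee_fin; apply: (le_trans (HCq _ rho%:C HE)).
    rewrite EFinM lee_wpmul2l ?lee_fin ?(ltW Cq0)//; apply: (le_trans (H2 _ mF)).
    by rewrite EFinM lee_wpmul2l ?lee_fin ?(ltW C0).
  case/andP: k01 => k0 _.
  have {}lower := lee_wpmul2r (_ : 0 <= (expR (- (alpha / 2) * rho ^+ 2))%:E)%E lower.
  have W0 : 0 < expR (- (alpha / 2) * rho ^+ 2) by exact: expR_gt0.
  have {lower} := lower ltac:(by rewrite lee_fin ltW).
  rewrite -EFinM => lower.
  have nrho : normc rho%:C = rho by rewrite normcR ger0_norm// peak_radius_ge0.
  rewrite /fock_weighted nrho in upper.
  rewrite -lee_fin in upper; have := le_trans lower upper.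
  rewrite muleAC -EFinM.
  have -> : rho ^+ n * (a^-1 ^+ n * a^-1) * expR (- (alpha / 2) * rho ^+ 2) = peak alpha n *
    (a^-1 ^+ n * a^-1).
    by rewrite /peak -/rho; ring.
  have P0 := peak_gt0 alpha0 n.
  set m := mu _; have c0 : 0 < peak alpha n * (a^-1 ^+ n * a^-1).
    by apply: mulr_gt0 => //; apply: mulr_gt0; rewrite ?exprn_gt0 ?invr_gt0.
  move=> H; rewrite -(@lee_pmul2l _ (peak alpha n * (a^-1 ^+ n * a^-1))%:E) ?lte_fin//.
  apply: le_trans H _; rewrite -EFinM lee_fin le_eqVlt; apply/orP; left; apply/eqP.
  rewrite [(a / kappa) ^+ n]expr_div_n [a^-1 ^+ n]exprVn.
  have kn : kappa ^+ n != 0 by rewrite gt_eqF// exprn_gt0.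
  have an : a ^+ n != 0 by rewrite gt_eqF// exprn_gt0.
  set X := kappa ^+ n in kn *; set Y := a ^+ n in an *.
  by field; rewrite kn an gt_eqF.
have M0 : (0 <= mu [set` `]0%R, a]%R])%E by exact: measure_ge0.
(* The case [n = 0] already shows that the mass is finite. *)
case: (mu _) M0 main => [m| |]// m0 main; last by have := main 0%N; rewrite leye_eq.
rewrite lee_fin in m0; congr EFin; apply/le_anti; rewrite m0 andbT.
by apply: le0_of_geometric ak _ => n; have := main n; rewrite lee_fin; exact.
Qed.

Lemma bounded_null (p q : \bar R) : (0 < p)%E -> (p < q)%E ->
  hausdorff_bounded mu alpha p q -> mu `]0, 1[%classic = 0%E.
Proof.
move=> p0 pq H; apply: measure_negligible; first exact: measurable_itv.
have -> : (`]0, 1[%classic : set R) = \bigcup_n (`]0, n.+1%:R / n.+2%:R]%classic : set R).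
  rewrite eqEsubset; split => [t|t [n _]]; rewrite /= !in_itv/= => /andP[t0 t1]; last first.
    by rewrite t0 (le_lt_trans t1)// ltr_pdivrMr// mul1r ltr_nat.
  have u0 : 0 < 1 - t by rewrite subr_gt0.
  exists (Num.bound (1 - t)^-1) => //; rewrite /= in_itv/= t0 /= ler_pdivlMr//.
  have : (1 - t)^-1 < (Num.bound (1 - t)^-1)%:R by apply: archi_boundP; rewrite invr_ge0 ltW.
  set N := Num.bound _; rewrite -[X in X < _]mul1r ltr_pdivrMr// => HN.
  rewrite -[N.+2]/(2 + N)%N -[N.+1]/(1 + N)%N !natrD; nra.
apply: negligible_bigcup => n; apply/negligibleP; first exact: measurable_itv.
apply: (bounded_null_itv p0 pq H); rewrite divr_gt0//= ltr_pdivrMr// mul1r ltr_nat//.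
Qed.

End bounded_implies_supported.

Theorem corollary4p1 (R : realType) (alpha : R)
    (mu : {measure set R -> \bar R})
    (halpha : 0 < alpha)
    (hmu_supp : mu [set` `]-oo, 0]] = 0%E)
    (hmu : (\int[mu]_(t in [set` `]0, +oo[%R]) (t^-1)%:E = 1)%E) :
  (exists p q : \bar R, (0 < p)%E /\ (p < q)%E /\
     hausdorff_bounded mu alpha p q) <->
  (forall p : \bar R, (0 < p)%E -> hausdorff_bounded mu alpha p p).
Proof.
split=> [[p [q [p0 [pq H]]]] r r0|H].
  exact: hausdorff_bounded_diag halpha hmu (bounded_null halpha p0 pq H) r r0.
have lt01 : (0 < 1%:E :> \bar R)%E by rewrite lte_fin.
exists 1%:E, +oo%E; split => //; split; first exact: ltry.
exact: hausdorff_bounded_embedding (H _ lt01).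
Qed.
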